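(* Let $X$ be a topological space, $\mathcal{O}_B$ a sheaf of $\mathbf{Q}$-algebras on $X$ and $\mathcal{O}_X$ a sheaf of $\mathcal{O}_B$-algebras. Let $\mathcal{F}$ be a sheaf of $\mathcal{O}_X$-modules and $D\colon\mathcal{O}_X\to\mathcal{F}$ an $\mathcal{O}_B$-derivation. If $D$ is integrable, then there exists a flat, extended $D$-connection $T=(T_0,T_1,T_2,\dots)\colon\mathcal{F}\to\prod_{i=0}^\infty\mathcal{R}^{i+1}(\mathcal{F})$.
   Context: All rings are commutative $\mathbf{Q}$-algebras, apart from the tensor algebra $\mathcal{T}(\mathcal{F})$ and its quotients $\mathcal{R}(\mathcal{F})$, $\mathcal{A}(\mathcal{F})$ below. Tensor products are over $\mathcal{O}_X$. Tensor operations. For $n\ge 0$ let $\mathcal{T}^n(\mathcal{F})$, $\mathcal{S}^n(\mathcal{F})$, $\mathcal{A}^n(\mathcal{F})$ be the $n$-th tensor, symmetric and exterior powers of $\mathcal{F}$ over $\mathcal{O}_X$, and $\mathcal{T}(\mathcal{F})=\prod_{n\ge0}\mathcal{T}^n(\mathcal{F})$. Set $\mathcal{R}^0(\mathcal{F}):=\mathcal{O}_X$, $\mathcal{R}^n(\mathcal{F}):=\mathcal{S}^{n-1}(\mathcal{F})\otimes\mathcal{F}$ for $n\ge1$ (so $\mathcal{R}^1(\mathcal{F})=\mathcal{F}$ and $\mathcal{R}^2(\mathcal{F})=\mathcal{T}^2(\mathcal{F})$), and $\mathcal{R}(\mathcal{F}):=\prod_{n\ge0}\mathcal{R}^n(\mathcal{F})$,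 which is naturally a graded $\mathcal{O}_X$-algebra quotient of $\mathcal{T}(\mathcal{F})$. Products are written by juxtaposition: $m_1\cdots m_n$ denotes the class in $\mathcal{R}^n(\mathcal{F})$ of $m_1\otimes\cdots\otimes m_n$, which does not change when $m_1,\dots,m_{n-1}$ are permuted. The product of sections of $\mathcal{R}^a(\mathcal{F})$ and $\mathcal{R}^b(\mathcal{F})$ is in $\mathcal{R}^{a+b}(\mathcal{F})$. Switch operator. For $n\ge2$ let $\sigma\colon\mathcal{R}^n(\mathcal{F})\to\mathcal{R}^n(\mathcal{F})$ be the $\mathcal{O}_X$-linear map with $$\sigma(m_1\cdots m_n)=\sum_{i=1}^{n-1}m_nm_{n-1}\cdots m_{n-i+1}\,m_1m_2\cdots m_{n-i},$$ let $\sigma=0$ on $\mathcal{R}^1(\mathcal{F})=\mathcal{F}$, and put $\sigma^\star:=1+\sigma$. Set $\mathcal{K}^n(\mathcal{F}):=\sigma^\star(\mathcal{R}^n(\mathcal{F}))\subseteq\mathcal{R}^n(\mathcal{F})$ for $n\ge1$; it is the subsheaf generated locally by the sections $\sum_{i=1}^n m_1\cdots\widehat{m_i}\cdots m_n\,m_i$. In particular $\mathcal{K}^2(\mathcal{F})$ is the kernel of $\mathcal{T}^2(\mathcal{F})\to\mathcal{A}^2(\mathcal{F})$. $D$-connections. A $D$-connection is a map of $\mathcal{O}_B$-modules $\gamma\colon\mathcal{F}\to\mathcal{T}^2(\mathcal{F})$ with $\gamma(am)=D(a)m+a\gamma(m)$ for all local sections $a$ of $\mathcal{O}_X$ and $m$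 of $\mathcal{F}$ (here $D(a)m$ is $D(a)\otimes m$). It is flat if $\gamma D(\mathcal{O}_X)\subseteq\mathcal{K}^2(\mathcal{F})$. The derivation $D$ is integrable if there exists a flat $D$-connection (on $X$). Extended $D$-connections. An extended $D$-connection is a map of $\mathcal{O}_B$-modules $T=(T_0,T_1,T_2,\dots)\colon\mathcal{F}\to\prod_{i=0}^\infty\mathcal{R}^{i+1}(\mathcal{F})$ such that $T_0=\mathrm{id}_{\mathcal{F}}$ and, for each $i\ge1$ and all local sections $a$ of $\mathcal{O}_X$ and $m$ of $\mathcal{F}$, $$T_i(am)=aT_i(m)+\sum_{j=1}^i\frac1j\,T_{j-1}D(a)\,T_{i-j}(m),$$ where $T_{j-1}D(a):=T_{j-1}(D(a))\in\mathcal{R}^j(\mathcal{F})$ and the products are in $\mathcal{R}(\mathcal{F})$. It is flat if $T_iD(\mathcal{O}_X)\subseteq\mathcal{K}^{i+1}(\mathcal{F})$ for all $i\ge0$. *)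

(* Defs.v *)
From HB Require Import structures.
From mathcomp Require Import all_boot all_order all_algebra.
From mathcomp Require Import boolp classical_sets topology_structure.

Set Implicit Arguments.
Unset Strict Implicit.
Unset Printing Implicit Defensive.

Import GRing.Theory.
Local Open Scope classical_set_scope.
Local Open Scope quotient_scope.
Local Open Scope ring_scope.

(* The rings are [comPzRingType]s, the commutative rings in which 1 = 0 is    *)
(* allowed: a sheaf of rings takes the zero ring on the empty open set.       *)

Definition semilin (R S : comPzRingType) (rho : R -> S)
    (M : lmodType R) (N : lmodType S) (f : M -> N) : Prop :=
  forall a x y, f (a *: x + y) = rho a *: f x + f y.

Section Semilinear.
Variables (R S : comPzRingType) (rho : {rmorphism R -> S}).
Variables (M : lmodType R) (N : lmodType S).

Lemma semilinD (f : M -> N) : semilin rho f -> {morph f : x y / x + y}.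
Proof. by move=> h x y; have := h 1 x y; rewrite rmorph1 !scale1r. Qed.

Lemma semilin0 (f : M -> N) : semilin rho f -> f 0 = 0.
Proof.
by move=> h; apply: (@addrI _ (f 0)); rewrite -(semilinD h) !addr0.
Qed.

Lemma semilinZ (f : M -> N) : semilin rho f -> forall a x, f (a *: x) = rho a *: f x.
Proof. by move=> h a x; rewrite -[a *: x]addr0 h semilin0 ?addr0. Qed.

Lemma semilin_sum (f : M -> N) (I : Type) (r : seq I) (P : pred I) (F : I -> M) :
  semilin rho f -> f (\sum_(i <- r | P i) F i) = \sum_(i <- r | P i) f (F i).
Proof. by move=> h; apply: big_morph; [exact: semilinD|exact: semilin0]. Qed.

Lemma semilin_sumf (I : Type) (r : seq I) (P : pred I) (f : I -> M -> N) :
  (forall i, semilin rho (f i)) -> semilin rho (fun x => \sum_(i <- r | P i) f i x).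
Proof.
move=> h a x y; rewrite scaler_sumr -big_split /=.
by apply: eq_bigr => i _; rewrite h.
Qed.

End Semilinear.

Lemma semilin_comp (R S T : comPzRingType) (rho : R -> S) (tau : S -> T)
    (M : lmodType R) (N : lmodType S) (Q : lmodType T) (f : M -> N) (g : N -> Q) :
  semilin rho f -> semilin tau g -> semilin (tau \o rho) (g \o f).
Proof. by move=> hf hg a x y; rewrite /= hf hg. Qed.

(* The free R-module on I, as formal sums, modulo the submodule generated by  *)
(* the differences s - t with rel s t.                                        *)
Section Presented.
Variables (R : comPzRingType) (I : choiceType).
Variable rel : seq (R * I) -> seq (R * I) -> Prop.

Definition fscale (a : R) (s : seq (R * I)) := [seq (a * p.1, p.2) | p <- s].

Inductive pres_cong : seq (R * I) -> seq (R * I) -> Prop :=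
| PresRel s t of rel s t : pres_cong s t
| PresRefl s : pres_cong s s
| PresSym s t of pres_cong s t : pres_cong t s
| PresTrans s t u of pres_cong s t & pres_cong t u : pres_cong s u
| PresCat s s' t t' of pres_cong s s' & pres_cong t t' :
    pres_cong (s ++ t) (s' ++ t')
| PresComm s t : pres_cong (s ++ t) (t ++ s)
| PresScale a s t of pres_cong s t : pres_cong (fscale a s) (fscale a t)
| PresAdd a b i : pres_cong [:: (a + b, i)] [:: (a, i); (b, i)]
| PresZero i : pres_cong [:: (0, i)] [::].

Definition pres_eqb s t := `[< pres_cong s t >].

Lemma pres_eqb_refl : reflexive pres_eqb.
Proof. by move=> s; apply/asboolP; apply: PresRefl. Qed.

Lemma pres_eqb_sym : symmetric pres_eqb.
Proof. by move=> s t; apply/asboolP/asboolP; apply: PresSym. Qed.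

Lemma pres_eqb_trans : transitive pres_eqb.
Proof.
by move=> t s u /asboolP st /asboolP tu; apply/asboolP; apply: PresTrans st tu.
Qed.

Canonical pres_equiv :=
  EquivRel pres_eqb pres_eqb_refl pres_eqb_sym pres_eqb_trans.

Definition pres := {eq_quot pres_equiv}.

HB.instance Definition _ := Choice.on pres.
HB.instance Definition _ := EqQuotient.on pres.

Definition pclass (s : seq (R * I)) : pres := \pi_pres s.

Lemma pclassP s t : pclass s = pclass t <-> pres_cong s t.
Proof.
by split=> [/eqmodP/asboolP|h] //; apply/eqmodP/asboolP.
Qed.

Lemma pclassK (x : pres) : pclass (repr x) = x.
Proof. exact: reprK. Qed.

Lemma reprP s : pres_cong (repr (pclass s)) s.
Proof. by apply/pclassP; rewrite pclassK. Qed.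

Definition pres_add (x y : pres) : pres := pclass (repr x ++ repr y).
Definition pres_scale (a : R) (x : pres) : pres := pclass (fscale a (repr x)).

Lemma pres_addE s t : pres_add (pclass s) (pclass t) = pclass (s ++ t).
Proof. by rewrite /pres_add; apply/pclassP; apply: PresCat; apply: reprP. Qed.

Lemma pres_scaleE a s : pres_scale a (pclass s) = pclass (fscale a s).
Proof. by rewrite /pres_scale; apply/pclassP; apply: PresScale; apply: reprP. Qed.

Lemma pclass_ind (P : pres -> Prop) : (forall s, P (pclass s)) -> forall x, P x.
Proof. by move=> h x; rewrite -[x]pclassK. Qed.

Lemma fscale0 s : pres_cong (fscale 0 s) [::].
Proof.
elim: s => [|[b i] s IHs]; first exact: PresRefl.
rewrite /fscale map_cons /= mul0r -cat1s -[[::]]cats0.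
by apply: PresCat IHs; apply: PresZero.
Qed.

Lemma fscaleD a b s : pres_cong (fscale (a + b) s) (fscale a s ++ fscale b s).
Proof.
elim: s => [|[c i] s IHs]; first exact: PresRefl.
rewrite /= mulrDl -cat1s.
apply: PresTrans (PresCat (PresAdd _ _ _) IHs) _.
set A := fscale a s; set B := fscale b s.
change (pres_cong ([:: (a * c, i)] ++ (([:: (b * c, i)] ++ A) ++ B))
                  ([:: (a * c, i)] ++ (A ++ ([:: (b * c, i)] ++ B)))).
apply: PresCat; first exact: PresRefl.
by rewrite catA; apply: PresCat; [apply: PresComm|apply: PresRefl].
Qed.

Fact pres_addA : associative pres_add.
Proof.
elim/pclass_ind=> s; elim/pclass_ind=> t; elim/pclass_ind=> u.
by rewrite !pres_addE catA.
Qed.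

Fact pres_addC : commutative pres_add.
Proof.
elim/pclass_ind=> s; elim/pclass_ind=> t; rewrite !pres_addE.
by apply/pclassP; apply: PresComm.
Qed.

Fact pres_add0 : left_id (pclass [::]) pres_add.
Proof. by elim/pclass_ind=> s; rewrite pres_addE. Qed.

Fact pres_addN : left_inverse (pclass [::]) (pres_scale (-1)) pres_add.
Proof.
elim/pclass_ind=> s; rewrite pres_scaleE pres_addE; apply/pclassP.
have fscale1 : fscale 1 s = s.
  by rewrite /fscale -[RHS]map_id; apply: eq_map => -[b i] /=; rewrite mul1r.
rewrite -{2}fscale1; apply: PresTrans (fscale0 s).
by rewrite -(addNr 1); apply: PresSym; apply: fscaleD.
Qed.

HB.instance Definition _ :=
  GRing.isZmodule.Build pres pres_addA pres_addC pres_add0 pres_addN.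

Lemma pclassD s t : pclass s + pclass t = pclass (s ++ t).
Proof. exact: pres_addE. Qed.

Fact pres_scaleA a b x : pres_scale a (pres_scale b x) = pres_scale (a * b) x.
Proof.
elim/pclass_ind: x => s; rewrite !pres_scaleE; congr pclass.
by rewrite /fscale -map_comp; apply: eq_map => -[c i] /=; rewrite mulrA.
Qed.

Fact pres_scale1 : left_id 1 pres_scale.
Proof.
elim/pclass_ind=> s; rewrite pres_scaleE; congr pclass.
by rewrite /fscale -[RHS]map_id; apply: eq_map => -[b i] /=; rewrite mul1r.
Qed.

Fact pres_scaleDr : right_distributive pres_scale +%R.
Proof.
move=> a; elim/pclass_ind=> s; elim/pclass_ind=> t.
by rewrite pclassD !pres_scaleE pclassD /fscale map_cat.
Qed.

Fact pres_scaleDl x : {morph pres_scale^~ x : a b / a + b}.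
Proof.
move=> a b; elim/pclass_ind: x => s; rewrite !pres_scaleE.
by rewrite pclassD; apply/pclassP; apply: fscaleD.
Qed.

HB.instance Definition _ := GRing.Zmodule_isLmodule.Build R pres
  pres_scaleA pres_scale1 pres_scaleDr pres_scaleDl.

Lemma pclassZ a s : a *: pclass s = pclass (fscale a s).
Proof. exact: pres_scaleE. Qed.

Definition pgen (i : I) : pres := pclass [:: (1, i)].

Lemma pclassE s : pclass s = \sum_(p <- s) p.1 *: pgen p.2.
Proof.
elim: s => [|[a i] s IHs]; first by rewrite big_nil.
by rewrite big_cons -IHs /pgen pclassZ pclassD /= mulr1.
Qed.

Lemma pres_ind (P : pres -> Prop) :
  P 0 -> (forall a i x, P x -> P (a *: pgen i + x)) -> forall x, P x.
Proof.
move=> h0 hS; elim/pclass_ind=> s; rewrite pclassE.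
elim: s => [|[a i] s IHs]; first by rewrite big_nil.
by rewrite big_cons; apply: hS.
Qed.

End Presented.

Section PresentedLift.
Variables (R S : comPzRingType) (rho : {rmorphism R -> S}) (I : choiceType).
Variable rel : seq (R * I) -> seq (R * I) -> Prop.
Variables (N : lmodType S) (f : I -> N).

Definition pres_ev (s : seq (R * I)) : N := \sum_(p <- s) rho p.1 *: f p.2.

(* The rho-semilinear map extending f; meaningful when [pres_ev] respects the *)
(* relations.                                                                 *)
Definition plift (x : pres rel) : N := pres_ev (repr x).

Hypothesis relP : forall s t, rel s t -> pres_ev s = pres_ev t.

Lemma pres_ev_cong s t : pres_cong rel s t -> pres_ev s = pres_ev t.
Proof.
have evc u v : pres_ev (u ++ v) = pres_ev u + pres_ev v by apply: big_cat.
have evZ a u : pres_ev (fscale a u) = rho a *: pres_ev u.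
  rewrite /pres_ev big_map scaler_sumr; apply: eq_bigr => p _ /=.
  by rewrite rmorphM scalerA.
elim=> {s t}; rewrite ?evc.
- exact: relP.
- by [].
- by move=> s t _ ->.
- by move=> s t u _ -> _ ->.
- by move=> s s' t t' _ h _ h'; rewrite !evc h h'.
- by move=> s t; rewrite !evc addrC.
- by move=> a s t _ h; rewrite !evZ h.
- move=> a b i; rewrite /pres_ev !big_cons !big_nil /= !addr0.
  by rewrite rmorphD scalerDl.
- by move=> i; rewrite /pres_ev big_cons !big_nil /= rmorph0 scale0r addr0.
Qed.

Lemma plift_class s : plift (pclass rel s) = pres_ev s.
Proof. by apply: pres_ev_cong; apply: reprP. Qed.

Lemma plift_gen i : plift (pgen rel i) = f i.
Proof.
by rewrite plift_class /pres_ev big_seq1 /= rmorph1 scale1r.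
Qed.

Lemma plift_semilin : semilin rho plift.
Proof.
move=> a; elim/pclass_ind=> s; elim/pclass_ind=> t.
rewrite pclassZ pclassD !plift_class /pres_ev big_cat /= big_map scaler_sumr.
by congr (_ + _); apply: eq_bigr => p _ /=; rewrite rmorphM scalerA.
Qed.

End PresentedLift.

Lemma pres_eq (R S : comPzRingType) (rho : {rmorphism R -> S}) (I : choiceType)
    (rel : seq (R * I) -> seq (R * I) -> Prop) (N : lmodType S)
    (f g : pres rel -> N) :
  semilin rho f -> semilin rho g ->
  (forall i, f (pgen rel i) = g (pgen rel i)) -> f =1 g.
Proof.
move=> hf hg fg; elim/pres_ind => [|a i x fgx].
  by rewrite (semilin0 hf) (semilin0 hg).
by rewrite hf hg fg fgx.
Qed.

Section Tensor.
Variables (R : comPzRingType) (M N : lmodType R).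

Inductive tens_rel :
    seq (R * (M * N)%type) -> seq (R * (M * N)%type) -> Prop :=
| TensRelL a x x' y :
    tens_rel [:: (1, (a *: x + x', y))] [:: (a, (x, y)); (1, (x', y))]
| TensRelR a x y y' :
    tens_rel [:: (1, (x, a *: y + y'))] [:: (a, (x, y)); (1, (x, y'))].

Definition tens : lmodType R := pres tens_rel.

Definition tpure (x : M) (y : N) : tens := pgen tens_rel (x, y).

Lemma tpure_linl y : semilin idfun (tpure^~ y).
Proof.
move=> a x x'; rewrite /tpure /pgen pclassZ pclassD /= mulr1.
by apply/pclassP/PresRel/TensRelL.
Qed.

Lemma tpure_linr x : semilin idfun (tpure x).
Proof.
move=> a y y'; rewrite /tpure /pgen pclassZ pclassD /= mulr1.
by apply/pclassP/PresRel/TensRelR.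
Qed.

Section Lift.
Variables (S : comPzRingType) (rho : {rmorphism R -> S}) (Q : lmodType S).

Definition tlift (f : M -> N -> Q) : tens -> Q :=
  plift rho (fun p => f p.1 p.2).

Variable f : M -> N -> Q.
Hypotheses (fl : forall y, semilin rho (f^~ y)) (fr : forall x, semilin rho (f x)).

Lemma tlift_rel s t : tens_rel s t ->
  pres_ev rho (fun p => f p.1 p.2) s = pres_ev rho (fun p => f p.1 p.2) t.
Proof.
case=> *; rewrite /pres_ev !big_cons !big_nil /= !addr0 rmorph1 !scale1r.
  exact: fl.
exact: fr.
Qed.

Lemma tlift_semilin : semilin rho (tlift f).
Proof. exact: plift_semilin tlift_rel. Qed.

Lemma tlift_pure x y : tlift f (tpure x y) = f x y.
Proof. exact: (plift_gen tlift_rel). Qed.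

End Lift.

Lemma tens_eq (S : comPzRingType) (rho : {rmorphism R -> S}) (Q : lmodType S)
    (f g : tens -> Q) :
  semilin rho f -> semilin rho g ->
  (forall x y, f (tpure x y) = g (tpure x y)) -> f =1 g.
Proof. by move=> hf hg fg; apply: (pres_eq hf hg) => -[x y]; apply: fg. Qed.

End Tensor.

Section SymmetricPower.
Variables (R : comPzRingType) (n : nat) (M : lmodType R).

Inductive sym_rel : seq (R * n.-tuple M) -> seq (R * n.-tuple M) -> Prop :=
| SymRelPerm (v w : n.-tuple M) of perm_eq v w :
    sym_rel [:: (1, v)] [:: (1, w)]
| SymRelLin a x y (s t : seq M) (u v w : n.-tuple M)
    of u = s ++ (a *: x + y) :: t :> seq M
     & v = s ++ x :: t :> seq M & w = s ++ y :: t :> seq M :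
    sym_rel [:: (1, u)] [:: (a, v); (1, w)].

Definition sym : lmodType R := pres sym_rel.

(* The product in S^n(M) of the letters of s, when s has length n.            *)
Definition sword (s : seq M) : sym :=
  if insub s is Some v then pgen sym_rel v else 0.

Lemma sword_tuple (v : n.-tuple M) : sword v = pgen sym_rel v.
Proof. by rewrite /sword valK. Qed.

Lemma sword_size s : size s <> n -> sword s = 0.
Proof. by move=> h; rewrite /sword insubN //; apply/eqP. Qed.

Lemma sword_perm s t : perm_eq s t -> sword s = sword t.
Proof.
move=> st; have [hs|hs] := eqVneq (size s) n; last first.
  by rewrite !sword_size // -?(perm_size st); apply/eqP.
have ht : size t = n by rewrite -(perm_size st).
move: {1}hs {1}ht => /eqP s_n /eqP t_n.
rewrite -[s]/(val (Tuple s_n)) -[t]/(val (Tuple t_n)) !sword_tuple.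
by apply/pclassP/PresRel/SymRelPerm.
Qed.

Lemma sword_lin s t : semilin idfun (fun x => sword (s ++ x :: t)).
Proof.
move=> a x y; have [h|h] := eqVneq (size (s ++ x :: t)) n; last first.
  rewrite !sword_size ?scaler0 ?addr0 //; apply/eqP;
  by move: h; rewrite !size_cat.
have h1 : size (s ++ x :: t) == n by apply/eqP.
have h2 : size (s ++ y :: t) == n by move: h1; rewrite !size_cat.
have h3 : size (s ++ (a *: x + y) :: t) == n by move: h1; rewrite !size_cat.
have := sword_tuple (Tuple h1); have := sword_tuple (Tuple h2).
have := sword_tuple (Tuple h3) => /= -> -> ->.
rewrite /= /pgen pclassZ pclassD /= mulr1.
by apply/pclassP/PresRel/(SymRelLin (s := s) (t := t)).
Qed.

Section Lift.
Variables (S : comPzRingType) (rho : {rmorphism R -> S}) (Q : lmodType S).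

Definition slift (f : seq M -> Q) : sym -> Q :=
  plift rho (fun v : n.-tuple M => f v).

Variable f : seq M -> Q.
Hypothesis fperm : forall s t, size s = n -> perm_eq s t -> f s = f t.
Hypothesis flin : forall s, (size s).+1 = n -> semilin rho (fun x => f (x :: s)).

Lemma slift_rel s t : sym_rel s t ->
  pres_ev rho (fun v : n.-tuple M => f v) s =
  pres_ev rho (fun v : n.-tuple M => f v) t.
Proof.
case=> [v w vw|a x y p q u v w eu ev ew];
  rewrite /pres_ev !big_cons !big_nil /= !addr0 rmorph1 !scale1r.
  by apply: fperm => //; rewrite size_tuple.
have hp z : perm_eq (p ++ z :: q) (z :: (p ++ q)) by rewrite perm_catC /= perm_cons perm_catC.
rewrite (fperm _ (s := u) (t := (a *: x + y) :: (p ++ q))) ?size_tuple ?eu //.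
rewrite (fperm _ (s := v) (t := x :: (p ++ q))) ?size_tuple ?ev //.
rewrite (fperm _ (s := w) (t := y :: (p ++ q))) ?size_tuple ?ew //.
by apply: flin; rewrite -(size_tuple v) ev !size_cat /= addnS.
Qed.

Lemma slift_semilin : semilin rho (slift f).
Proof. exact: plift_semilin slift_rel. Qed.

Lemma slift_word s : size s = n -> slift f (sword s) = f s.
Proof.
move=> /eqP h; rewrite -[s]/(val (Tuple h)) sword_tuple.
exact: (plift_gen slift_rel).
Qed.

End Lift.

Lemma sym_eq (S : comPzRingType) (rho : {rmorphism R -> S}) (Q : lmodType S)
    (f g : sym -> Q) :
  semilin rho f -> semilin rho g ->
  (forall s, size s = n -> f (sword s) = g (sword s)) -> f =1 g.
Proof.
move=> hf hg fg; apply: (pres_eq hf hg) => v.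
by rewrite -sword_tuple; apply: fg; rewrite size_tuple.
Qed.

End SymmetricPower.

Section SymmetricProduct.
Variables (R : comPzRingType) (M : lmodType R) (a b : nat).

Implicit Types s t : seq M.

Definition smulw s : sym b M -> sym (a + b) M :=
  slift idfun (fun t => sword (a + b) (s ++ t)).

Definition smul (x : sym a M) (y : sym b M) : sym (a + b) M :=
  slift idfun (smulw^~ y) x.

Lemma smulw_linr s : semilin idfun (smulw s).
Proof.
apply: slift_semilin => [t u _ tu|t _]; last exact: sword_lin.
by apply: sword_perm; rewrite perm_cat2l.
Qed.

Lemma smulw_word s t :
  size t = b -> smulw s (sword b t) = sword (a + b) (s ++ t).
Proof.
move=> tb; apply: slift_word tb => [u v _ uv|u _]; last exact: sword_lin.
by apply: sword_perm; rewrite perm_cat2l.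
Qed.

Lemma smulw_perm s t y : perm_eq s t -> smulw s y = smulw t y.
Proof.
move=> st; rewrite /smulw; congr (slift _ _ y); apply/funext => u.
by apply: sword_perm; rewrite perm_cat2r.
Qed.

Lemma smulw_lin s y : semilin idfun (fun x => smulw (x :: s) y).
Proof.
move=> c x x'; move: y; apply: (sym_eq (rho := idfun)).
- exact: smulw_linr.
- move=> d y y'; rewrite !smulw_linr /= !scalerDr !scalerA mulrC -!addrA.
  by congr (_ + _); rewrite addrCA.
- by move=> t tb; rewrite !smulw_word // (sword_lin _ [::]).
Qed.

Lemma smul_wordl s y : size s = a -> smul (sword a s) y = smulw s y.
Proof.
apply: (slift_word (f := smulw^~ y)) => [u v _|u _]; first exact: smulw_perm.
exact: smulw_lin.
Qed.

Lemma smul_word s t : size s = a -> size t = b ->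
  smul (sword a s) (sword b t) = sword (a + b) (s ++ t).
Proof. by move=> sa tb; rewrite smul_wordl // smulw_word. Qed.

Lemma smul_linl y : semilin idfun (smul^~ y).
Proof.
apply: slift_semilin => [u v _|u _]; first exact: smulw_perm.
exact: smulw_lin.
Qed.

Lemma smul_linr x : semilin idfun (smul x).
Proof.
move=> c y y'; move: x; apply: (sym_eq (rho := idfun)).
- exact: smul_linl.
- move=> d x x'; rewrite !smul_linl /= !scalerDr !scalerA mulrC -!addrA.
  by congr (_ + _); rewrite addrCA.
- by move=> s sa; rewrite !smul_wordl // smulw_linr.
Qed.

End SymmetricProduct.
Section Rpow.
Variables (R : comPzRingType) (M : lmodType R).

(* The index is shifted: [Rpow k] is R^(k+1)(M).                              *)
Definition Rpow (k : nat) : lmodType R := tens (sym k M) M.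

(* The product m_1 ... m_(k+1) in R^(k+1)(M) of the letters of w.             *)
Definition rword (k : nat) (w : seq M) : Rpow k :=
  tpure (sword k (take k w)) (nth 0 w k).

Definition Rmulp a b (u : sym a M) (m : M) (v : sym b M) (m' : M) :
    Rpow (a + b.+1) :=
  tpure (smul u (smul (sword 1 [:: m]) v : sym b.+1 M)) m'.

(* The product R^(a+1)(M) x R^(b+1)(M) -> R^(a+b+2)(M), which concatenates    *)
(* words: (u (x) m) (v (x) m') = (u m v) (x) m'; see [Rmul_word].             *)
Definition Rmul a b (x : Rpow a) (y : Rpow b) : Rpow (a + b.+1) :=
  tlift idfun (fun u m => tlift idfun (Rmulp u m) y) x.

(* sigma (m_1 ... m_n), where n = k + 1                                       *)
Definition switchw k (w : seq M) : Rpow k :=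
  let n := k.+1 in
  \sum_(1 <= i < n) rword k (rev (drop (n - i) w) ++ take (n - i) w).

Definition switch k (x : Rpow k) : Rpow k :=
  tlift idfun (fun u m => slift idfun (fun s => switchw k (rcons s m)) u) x.

Lemma Rmulp_lin1 a b m v m' :
  semilin idfun (fun u : sym a M => Rmulp u m (v : sym b M) m').
Proof. by move=> c u u'; rewrite /Rmulp smul_linl tpure_linl. Qed.

Lemma Rmulp_lin2 a b (u : sym a M) (v : sym b M) m' :
  semilin idfun (fun m => Rmulp u m v m').
Proof.
move=> c m n; rewrite /Rmulp (sword_lin 1 [::] [::]) /=.
by rewrite smul_linl smul_linr tpure_linl.
Qed.

Lemma Rmulp_lin3 a b (u : sym a M) m m' :
  semilin idfun (fun v : sym b M => Rmulp u m v m').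
Proof. by move=> c v v'; rewrite /Rmulp !smul_linr tpure_linl. Qed.

Lemma Rmulp_lin4 a b (u : sym a M) m (v : sym b M) :
  semilin idfun (Rmulp u m v).
Proof. exact: tpure_linr. Qed.

Lemma RmulpE_linr a b (u : sym a M) m :
  semilin idfun (tlift (M := sym b M) idfun (Rmulp u m)).
Proof.
apply: tlift_semilin => [m'|v]; [exact: Rmulp_lin3|exact: Rmulp_lin4].
Qed.

Lemma RmulpE_pure a b (u : sym a M) m (v : sym b M) m' :
  tlift idfun (Rmulp u m) (tpure v m') = Rmulp u m v m'.
Proof.
apply: tlift_pure => [y|x]; [exact: Rmulp_lin3|exact: Rmulp_lin4].
Qed.

Lemma RmulpE_lin1 a b (y : Rpow b) m :
  semilin idfun (fun u : sym a M => tlift idfun (Rmulp u m) y).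
Proof.
move=> c u u'; move: y; apply: (tens_eq (rho := idfun)).
- exact: RmulpE_linr.
- move=> d y y'; rewrite !RmulpE_linr /= !scalerDr !scalerA mulrC -!addrA.
  by congr (_ + _); rewrite addrCA.
- by move=> v m'; rewrite !RmulpE_pure Rmulp_lin1.
Qed.

Lemma RmulpE_lin2 a b (y : Rpow b) (u : sym a M) :
  semilin idfun (fun m => tlift idfun (Rmulp u m) y).
Proof.
move=> c m n; move: y; apply: (tens_eq (rho := idfun)).
- exact: RmulpE_linr.
- move=> d y y'; rewrite !RmulpE_linr /= !scalerDr !scalerA mulrC -!addrA.
  by congr (_ + _); rewrite addrCA.
- by move=> v m'; rewrite !RmulpE_pure Rmulp_lin2.
Qed.

Lemma Rmul_linl a b (y : Rpow b) : semilin idfun (fun x : Rpow a => Rmul x y).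
Proof.
apply: tlift_semilin => [m|u]; [exact: RmulpE_lin1|exact: RmulpE_lin2].
Qed.

Lemma Rmul_purel a b (u : sym a M) m (y : Rpow b) :
  Rmul (tpure u m : Rpow a) y = tlift idfun (Rmulp u m) y.
Proof.
apply: (tlift_pure (f := fun u m => tlift idfun (Rmulp u m) y)) => [n|v].
  exact: RmulpE_lin1.
exact: RmulpE_lin2.
Qed.

Lemma Rmul_linr a b (x : Rpow a) : semilin idfun (fun y : Rpow b => Rmul x y).
Proof.
move=> c y y'; move: x; apply: (tens_eq (rho := idfun)).
- exact: Rmul_linl.
- move=> d x x'; rewrite !Rmul_linl /= !scalerDr !scalerA mulrC -!addrA.
  by congr (_ + _); rewrite addrCA.
- by move=> u m; rewrite !Rmul_purel RmulpE_linr.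
Qed.

Lemma Rmul_pure a b (u : sym a M) m (v : sym b M) m' :
  Rmul (tpure u m : Rpow a) (tpure v m' : Rpow b) = Rmulp u m v m'.
Proof. by rewrite Rmul_purel RmulpE_pure. Qed.

Lemma rword_rcons k s m : size s = k -> rword k (rcons s m) = tpure (sword k s) m.
Proof.
by move=> sk; rewrite /rword -cats1 take_size_cat // nth_cat sk ltnn subnn.
Qed.

Lemma Rmul_word a b (s t : seq M) : size s = a.+1 -> size t = b.+1 ->
  Rmul (rword a s) (rword b t) = rword (a + b.+1) (s ++ t).
Proof.
case/lastP: s => [//|s m]; rewrite size_rcons => -[sa].
case/lastP: t => [//|t n]; rewrite size_rcons => -[tb].
rewrite -rcons_cat !rword_rcons ?size_cat ?size_rcons ?sa ?tb //; last first.
  by rewrite addSnnS.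
rewrite Rmul_pure /Rmulp; congr (tpure _ n).
have -> : smul (sword 1 [:: m]) (sword b t) = sword b.+1 (m :: t) by exact: smul_word.
by rewrite smul_word ?cat_rcons //= tb.
Qed.

Lemma switchwE k s m : size s = k ->
  switchw k (rcons s m) = \sum_(x <- s) tpure (sword k (m :: rem x s)) x.
Proof.
move=> sk; rewrite (big_nth 0) sk /switchw big_add1 /= big_nat_rev /= add0n.
apply: eq_big_nat => j /andP[_ jk].
have -> : (k.+1 - (k - j.+1).+1 = j.+1)%N by rewrite subSS subKn.
rewrite drop_rcons ?sk // rev_rcons -cats1 takel_cat ?sk //.
rewrite (take_nth 0) ?sk // cat_cons -rcons_cat -rcons_cons rword_rcons; last first.
  by rewrite /= size_cat size_rev size_drop size_take sk jk -addSn subnSK ?subnK // ltnW.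
congr (tpure _ _); apply: sword_perm; rewrite perm_cons.
have sj : nth 0 s j \in s by rewrite mem_nth ?sk.
rewrite -(perm_cons (nth 0 s j)).
rewrite perm_sym; apply: perm_trans (_ : perm_eq s _); first by rewrite perm_sym perm_to_rem.
rewrite -{1}(cat_take_drop j s) (drop_nth 0) ?sk // perm_catC /= perm_cons.
by rewrite perm_cat2r perm_sym perm_rev.
Qed.

Lemma switchw_perm k m s t : size s = k -> perm_eq s t ->
  switchw k (rcons s m) = switchw k (rcons t m).
Proof.
move=> sk st; rewrite !switchwE // -?(perm_size st) //.
rewrite (perm_big _ st) /=; apply: eq_bigr => x _.
congr (tpure _ _); apply: sword_perm; rewrite perm_cons.
have [xs|xs] := boolP (x \in s); last by rewrite !rem_id // -(perm_mem st).
rewrite -(perm_cons x); have xt : x \in t by rewrite -(perm_mem st).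
apply: perm_trans (perm_to_rem xt); apply: perm_trans st.
by rewrite perm_sym perm_to_rem.
Qed.

Lemma switchw_lin k m s : (size s).+1 = k ->
  semilin idfun (fun x => switchw k (rcons (x :: s) m)).
Proof.
move=> sk a x y; rewrite !switchwE //.
have remE z : \sum_(x <- z :: s) tpure (sword k (m :: rem x (z :: s))) x =
    tpure (sword k (m :: s)) z + \sum_(x <- s) tpure (sword k (m :: z :: rem x s)) x.
  rewrite big_cons /= eqxx; congr (_ + _); apply: eq_big_seq => w ws.
  congr (tpure _ _); apply: sword_perm; rewrite perm_cons.
  by rewrite /=; case: eqVneq => [zw|_]; [rewrite -zw in ws *; apply: perm_to_rem|exact: perm_refl].
rewrite !remE tpure_linr /= scalerDr -!addrA; congr (_ + _).
rewrite [RHS]addrCA; congr (_ + _); rewrite scaler_sumr -big_split /=.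
apply: eq_bigr => w _.
by rewrite (sword_lin _ [:: m]) tpure_linl.
Qed.

Lemma switchw_linr k s : size s = k ->
  semilin idfun (fun m => switchw k (rcons s m)).
Proof.
move=> sk a x y; rewrite !switchwE // scaler_sumr -big_split /=.
by apply: eq_bigr => w _; rewrite (sword_lin _ [::]) tpure_linl.
Qed.

Lemma switchu_lin k m :
  semilin idfun (slift (n := k) idfun (fun s => switchw k (rcons s m))).
Proof.
apply: slift_semilin => [s t|s sk]; first exact: switchw_perm.
exact: switchw_lin.
Qed.

Lemma switchu_word k m s : size s = k ->
  slift idfun (fun s => switchw k (rcons s m)) (sword k s) = switchw k (rcons s m).
Proof.
move=> sk; apply: (slift_word (f := fun s => switchw k (rcons s m))) sk.
  by move=> u v; apply: switchw_perm.
by move=> u; apply: switchw_lin.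
Qed.

Lemma switchu_linr k (u : sym k M) :
  semilin idfun (fun m => slift idfun (fun s => switchw k (rcons s m)) u).
Proof.
move=> c m n; move: u; apply: (sym_eq (rho := idfun)).
- exact: switchu_lin.
- move=> d u u'; rewrite !switchu_lin /= !scalerDr !scalerA mulrC -!addrA.
  by congr (_ + _); rewrite addrCA.
- by move=> s sk; rewrite !switchu_word // switchw_linr.
Qed.

Lemma switch_lin k : semilin idfun (@switch k).
Proof.
apply: tlift_semilin => [m|u]; [exact: switchu_lin|exact: switchu_linr].
Qed.

Lemma switch_word k w : size w = k.+1 -> switch (rword k w) = switchw k w.
Proof.
case/lastP: w => [//|s m]; rewrite size_rcons => -[sk].
rewrite rword_rcons // -[RHS]switchu_word //.
apply: (tlift_pure
  (f := fun u m => slift idfun (fun s => switchw k (rcons s m)) u)) => [n|u].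
  exact: switchu_lin.
exact: switchu_linr.
Qed.

Lemma Rpow_eq k (S : comPzRingType) (rho : {rmorphism R -> S}) (Q : lmodType S)
    (f g : Rpow k -> Q) :
  semilin rho f -> semilin rho g ->
  (forall w, size w = k.+1 -> f (rword k w) = g (rword k w)) -> f =1 g.
Proof.
move=> hf hg fg; apply: (tens_eq hf hg) => u m; move: u.
apply: (sym_eq (rho := rho)).
- by move=> a u u'; rewrite tpure_linl hf.
- by move=> a u u'; rewrite tpure_linl hg.
- by move=> s sk; rewrite -rword_rcons //; apply: fg; rewrite size_rcons sk.
Qed.

(* The identifications of T^2(M) with R^2(M) and of M with R^1(M).            *)
Definition tens_Rpow (x : tens M M) : Rpow 1 :=
  tlift idfun (fun m n => rword 1 [:: m; n]) x.

Definition Rpow_of (m : M) : Rpow 0 := rword 0 [:: m].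

Lemma tens_Rpow_linl n : semilin idfun (fun m => rword 1 [:: m; n]).
Proof. by move=> a x y; rewrite /rword /= (sword_lin _ [::]) tpure_linl. Qed.

Lemma tens_Rpow_linr m : semilin idfun (fun n => rword 1 [:: m; n]).
Proof. by move=> a x y; rewrite /rword /= tpure_linr. Qed.

Lemma tens_Rpow_lin : semilin idfun tens_Rpow.
Proof. exact: tlift_semilin tens_Rpow_linl tens_Rpow_linr. Qed.

Lemma tens_Rpow_pure m n : tens_Rpow (tpure m n) = rword 1 [:: m; n].
Proof. exact: (tlift_pure tens_Rpow_linl tens_Rpow_linr). Qed.

End Rpow.

Section Functoriality.
Variables (R S : comPzRingType) (rho : {rmorphism R -> S}).
Variables (M : lmodType R) (N : lmodType S) (phi : M -> N).
Hypothesis phiL : semilin rho phi.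

Definition tmap : tens M M -> tens N N :=
  tlift rho (fun x y => tpure (phi x) (phi y)).

Definition smap k : sym k M -> sym k N :=
  slift rho (fun s => sword k (map phi s)).

Definition Rmap k : Rpow M k -> Rpow N k :=
  tlift rho (fun u m => tpure (smap u) (phi m)).

Lemma tmap_lin : semilin rho tmap.
Proof.
by apply: tlift_semilin => u a v w; rewrite phiL (tpure_linl, tpure_linr).
Qed.

Lemma tmap_pure x y : tmap (tpure x y) = tpure (phi x) (phi y).
Proof.
apply: (tlift_pure (f := fun x y => tpure (phi x) (phi y))) => u a v w;
by rewrite phiL (tpure_linl, tpure_linr).
Qed.

Lemma smap_lin k : semilin rho (@smap k).
Proof.
apply: slift_semilin => [s t _ st|s _ a x y].
  by apply: sword_perm; apply: perm_map.
by rewrite /= phiL (sword_lin _ [::]).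
Qed.

Lemma smap_word k s : size s = k -> smap (sword k s) = sword k (map phi s).
Proof.
apply: (slift_word (f := fun s => sword k (map phi s))) => [u t _ st|u _ a x y].
  by apply: sword_perm; apply: perm_map.
by rewrite /= phiL (sword_lin _ [::]).
Qed.

Lemma Rmap_lin k : semilin rho (@Rmap k).
Proof.
apply: tlift_semilin => u a v w.
  by rewrite smap_lin tpure_linl.
by rewrite phiL tpure_linr.
Qed.

Lemma Rmap_word k w : size w = k.+1 -> Rmap (rword k w) = rword k (map phi w).
Proof.
case/lastP: w => [//|s m]; rewrite size_rcons => -[sk].
rewrite map_rcons !rword_rcons ?size_map // -smap_word //.
apply: (tlift_pure (f := fun u m => tpure (@smap k u) (phi m))) => u a v w.
  by rewrite smap_lin tpure_linl.
by rewrite phiL tpure_linr.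
Qed.

Lemma Rmap_mul a b (x : Rpow M a) (y : Rpow M b) :
  Rmap (Rmul x y) = Rmul (Rmap x) (Rmap y).
Proof.
move: x; apply: (Rpow_eq (rho := rho)).
- by move=> c x x'; rewrite Rmul_linl Rmap_lin.
- by move=> c x x'; rewrite Rmap_lin Rmul_linl.
move=> s sa; move: y; apply: (Rpow_eq (rho := rho)).
- by move=> c y y'; rewrite Rmul_linr Rmap_lin.
- by move=> c y y'; rewrite Rmap_lin Rmul_linr.
move=> t tb; rewrite Rmul_word // !Rmap_word ?Rmul_word ?map_cat ?size_map //.
by rewrite size_cat sa tb.
Qed.

Lemma Rmap_switch k (x : Rpow M k) : Rmap (switch x) = switch (Rmap x).
Proof.
move: x; apply: (Rpow_eq (rho := rho)).
- by move=> c x x'; rewrite switch_lin Rmap_lin.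
- by move=> c x x'; rewrite Rmap_lin switch_lin.
move=> w wk; rewrite Rmap_word // !switch_word ?size_map //.
rewrite /switchw (semilin_sum _ _ _ (@Rmap_lin k)).
apply: eq_big_nat => i /andP[i0 ik].
rewrite Rmap_word ?map_cat ?map_rev ?map_drop ?map_take //.
by rewrite size_cat size_rev addnC -size_cat cat_take_drop.
Qed.

Lemma Rmap_tens_Rpow (x : tens M M) : Rmap (tens_Rpow x) = tens_Rpow (tmap x).
Proof.
move: x; apply: (tens_eq (rho := rho)).
- by move=> c x x'; rewrite tens_Rpow_lin Rmap_lin.
- by move=> c x x'; rewrite tmap_lin tens_Rpow_lin.
- by move=> x y; rewrite tmap_pure !tens_Rpow_pure Rmap_word.
Qed.

End Functoriality.
Record opens (X : topologicalType) := Opens {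
  oset :> set X;
  oset_open : open oset
}.

Definition omem (X : topologicalType) (U : opens X) : X -> Prop := oset U.
Coercion omem : opens >-> Funclass.

Definition opensI (X : topologicalType) (U V : opens X) : opens X :=
  Opens (openI (oset_open U) (oset_open V)).

Section SheafAxioms.
Variables (X : topologicalType) (A : opens X -> Type).
Variable res : forall U V : opens X, V `<=` U -> A U -> A V.

Definition presheaf_axiom : Prop :=
  (forall (U : opens X) (h : U `<=` U) (s : A U), res h s = s) /\
  (forall (U V W : opens X) (UV : V `<=` U) (VW : W `<=` V) (UW : W `<=` U)
    (s : A U), res VW (res UV s) = res UW s).

Definition sheaf_axiom : Prop :=
  forall (U : opens X) (I : Type) (V : I -> opens X) (VU : forall i, V i `<=` U),
  (forall x, U x -> exists i, V i x) ->
  (forall s t : A U, (forall i, res (VU i) s = res (VU i) t) -> s = t) /\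
  (forall s : forall i, A (V i),
    (forall i j, res (@subIsetl _ (V i) (V j) : opensI (V i) (V j) `<=` V i) (s i) =
                 res (@subIsetr _ (V i) (V j) : opensI (V i) (V j) `<=` V j) (s j)) ->
    exists t : A U, forall i, res (VU i) t = s i).

End SheafAxioms.

Record ring_sheaf (X : topologicalType) := RingSheaf {
  rsec :> opens X -> comPzRingType;
  rres : forall U V : opens X, V `<=` U -> {rmorphism rsec U -> rsec V};
  rresP : presheaf_axiom rres;
  rsheafP : sheaf_axiom rres
}.

Record qalg_sheaf (X : topologicalType) := QalgSheaf {
  qsheaf :> ring_sheaf X;
  qalg : forall U, {rmorphism rat -> qsheaf U};
  qalg_res : forall (U V : opens X) (h : V `<=` U) (r : rat),
    rres qsheaf h (qalg U r) = qalg V r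
}.

Record alg_sheaf (X : topologicalType) (B : ring_sheaf X) := AlgSheaf {
  asheaf :> ring_sheaf X;
  alg : forall U, {rmorphism B U -> asheaf U};
  alg_res : forall (U V : opens X) (h : V `<=` U) (b : B U),
    rres asheaf h (alg U b) = alg V (rres B h b)
}.

Record mod_presheaf (X : topologicalType) (O : ring_sheaf X) := ModPresheaf {
  msec :> forall U, lmodType (O U);
  mres : forall U V : opens X, V `<=` U -> msec U -> msec V;
  mres_lin : forall (U V : opens X) (h : V `<=` U), semilin (rres O h) (mres h);
  mresP : presheaf_axiom mres
}.

Record mod_sheaf (X : topologicalType) (O : ring_sheaf X) := ModSheaf {
  mpresheaf :> mod_presheaf O;
  msheafP : sheaf_axiom (@mres X O mpresheaf)
}.

Arguments rres {X} _ {U V} _.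
Arguments mres {X O} _ {U V} _ _.
Arguments mres_lin {X O} _ {U V} _.
Arguments alg {X B} _ {U}.
Arguments qalg {X} _ {U}.

Section Germ.
Variables (X : topologicalType) (O : ring_sheaf X) (P : mod_presheaf O).
Implicit Types (x : X) (U V W : opens X).

(* Germs at x are the equivalence classes of the local sections around x      *)
(* (elements of [local_sec] on a neighbourhood of x) which agree near x.      *)
Definition local_sec := {V : opens X & P V}.

Definition germ (x : X) (V : opens X) (p : P V) : set local_sec :=
  [set q : local_sec | V x /\ exists (W : opens X) (WV : W `<=` V) (Wq : W `<=` tag q),
    W x /\ mres P WV p = mres P Wq (tagged q)].

(* Sections over U of the associated sheaf: maps sending each point of U to a *)
(* germ at this point, locally given by sections of P. By convention they are *)
(* extended by the empty set outside U.                                       *)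
Definition is_shsec (U : opens X) (s : X -> set local_sec) : Prop :=
  (forall x, ~ U x -> s x = set0) /\
  (forall x, U x -> exists (V : opens X) (p : P V),
    [/\ V `<=` U, V x & forall y, V y -> s y = germ y p]).

Record shsec (U : opens X) := ShSec {
  shval :> X -> set local_sec;
  shvalP : is_shsec U shval
}.

HB.instance Definition _ U := gen_eqMixin (shsec U).
HB.instance Definition _ U := gen_choiceMixin (shsec U).

Lemma mres_id (U : opens X) (h : U `<=` U) (p : P U) : mres P h p = p.
Proof. by have [h1 _] := mresP P; apply: h1. Qed.

Lemma mres_comp (U V W : opens X) (UV : V `<=` U) (VW : W `<=` V)
  (UW : W `<=` U) (p : P U) : mres P VW (mres P UV p) = mres P UW p.
Proof. by have [_ h2] := mresP P; apply: h2. Qed.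

Lemma mres_irr (U V : opens X) (h h' : V `<=` U) (p : P U) :
  mres P h p = mres P h' p.
Proof. by rewrite (Prop_irrelevance h h'). Qed.

Lemma mem_germ x V (p : P V) : V x -> germ x p (existT _ V p).
Proof. by move=> Vx; split=> //; exists V, (@subset_refl _ V), (@subset_refl _ V). Qed.

Lemma germP x V V' (p : P V) (p' : P V') : V x -> V' x ->
  germ x p = germ x p' <->
  exists (W : opens X) (WV : W `<=` V) (WV' : W `<=` V'),
    W x /\ mres P WV p = mres P WV' p'.
Proof.
move=> Vx V'x; split=> [e|[W [WV [WV' [Wx e]]]]].
  have : germ x p (existT _ V' p') by rewrite e; apply: mem_germ.
  by case=> _ [W [WV [WV' [Wx h]]]]; exists W, WV, WV'.
apply/seteqP; split=> -[Q q] [_ [Z [ZV [ZQ [Zx h]]]]]; split=> //=.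
  have h1 : opensI W Z `<=` W by apply: subIsetl.
  have h2 : opensI W Z `<=` Z by apply: subIsetr.
  exists (opensI W Z), (subset_trans h1 WV'), (subset_trans h2 ZQ); split; first by split.
  rewrite -(mres_comp WV' h1) -e -(mres_comp ZQ h2).
  by rewrite -h !(mres_comp _ _ (subset_trans h1 WV)).
have h1 : opensI W Z `<=` W by apply: subIsetl.
have h2 : opensI W Z `<=` Z by apply: subIsetr.
exists (opensI W Z), (subset_trans h1 WV), (subset_trans h2 ZQ); split; first by split.
rewrite -(mres_comp WV h1) e -(mres_comp ZQ h2) -h.
by rewrite !(mres_comp _ _ (subset_trans h1 WV')).
Qed.

Lemma germ_res x V W (h : W `<=` V) (p : P V) : W x -> germ x (mres P h p) = germ x p.
Proof.
move=> Wx; apply/germP => //; first exact: h.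
by exists W, (@subset_refl _ W), h; split=> //; rewrite mres_id.
Qed.

Definition rep (U : opens X) (s : shsec U) (V : opens X) (p : P V) : Prop :=
  V `<=` U /\ forall y, V y -> s y = germ y p.

Lemma rep_ex U (s : shsec U) x : U x -> exists V (p : P V), V x /\ rep s p.
Proof.
have [_ h] := shvalP s; move=> /h [V [p [VU Vx sp]]].
by exists V, p.
Qed.

Lemma rep_res U (s : shsec U) V W (h : W `<=` V) (p : P V) :
  rep s p -> rep s (mres P h p).
Proof.
move=> [VU sp]; split; first exact: subset_trans h VU.
by move=> y Wy; rewrite germ_res // sp //; apply: h.
Qed.

Lemma rep_ex2 U (s t : shsec U) x : U x ->
  exists V (p q : P V), [/\ V x, rep s p & rep t q].
Proof.
move=> Ux; have [V [p [Vx sp]]] := rep_ex s Ux.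
have [W [q [Wx tq]]] := rep_ex t Ux.
exists (opensI V W).
exists (mres P (@subIsetl _ V W : opensI V W `<=` V) p).
exists (mres P (@subIsetr _ V W : opensI V W `<=` W) q).
by split=> //; apply: rep_res.
Qed.

Lemma rep_ex3 U (s t u : shsec U) x : U x ->
  exists V (p q r : P V), [/\ V x, rep s p, rep t q & rep u r].
Proof.
move=> Ux; have [V [p [q [Vx sp tq]]]] := rep_ex2 s t Ux.
have [W [r [Wx ur]]] := rep_ex u Ux.
exists (opensI V W).
exists (mres P (@subIsetl _ V W : opensI V W `<=` V) p).
exists (mres P (@subIsetl _ V W : opensI V W `<=` V) q).
exists (mres P (@subIsetr _ V W : opensI V W `<=` W) r).
by split=> //; apply: rep_res.
Qed.

Lemma shsec_ext U (s t : shsec U) : (forall x, U x -> s x = t x) -> s = t.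
Proof.
case: s t => s hs [t ht] /= e.
have st : s = t.
  apply/funext => x; have [/e//|nUx] := pselect (U x).
  by rewrite (proj1 hs) // (proj1 ht).
by rewrite -st in ht *; rewrite (Prop_irrelevance hs ht).
Qed.

Lemma shsec_eq U (s t : shsec U) :
  (forall x, U x -> exists V (p : P V), [/\ V x, rep s p & rep t p]) -> s = t.
Proof.
move=> h; apply: shsec_ext => x /h [V [p [Vx [_ sp] [_ tp]]]].
by rewrite sp // tp.
Qed.

Lemma rep_uniq U (s : shsec U) V V' (p : P V) (p' : P V') x : V x -> V' x ->
  rep s p -> rep s p' -> exists (W : opens X) (WV : W `<=` V) (WV' : W `<=` V'),
    W x /\ mres P WV p = mres P WV' p'.
Proof.
by move=> Vx V'x [_ h] [_ h']; apply/(germP _ _ Vx V'x); rewrite -h // -h'.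
Qed.

Fact shunit_subproof U (p : P U) : is_shsec U (fun x => germ x p).
Proof.
split=> [x nUx|x Ux]; last by exists U, p; split=> //; apply: subset_refl.
by apply/seteqP; split=> // q [] /nUx.
Qed.

Definition shunit U (p : P U) : shsec U := ShSec (shunit_subproof p).

Lemma rep_shunit U (p : P U) V (h : V `<=` U) : rep (shunit p) (mres P h p).
Proof. by split=> // y Vy; rewrite germ_res. Qed.

Section Restriction.
Variables (U V : opens X) (VU : V `<=` U) (s : shsec U).

Fact shres_subproof : is_shsec V (fun x => [set r | V x /\ s x r]).
Proof.
split=> [x nVx|x Vx]; first by apply/seteqP; split=> // q [] /nVx.
have [W [p [Wx sp]]] := rep_ex s (VU Vx).
have h1 : opensI V W `<=` V by apply: subIsetl.
have h2 : opensI V W `<=` W by apply: subIsetr.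
exists (opensI V W), (mres P h2 p); split=> // y [Vy Wy].
rewrite germ_res // -(proj2 sp) //.
by apply/seteqP; split=> // q [].
Qed.

Definition shres : shsec V := ShSec shres_subproof.

Lemma shresE x : V x -> shres x = s x.
Proof. by move=> Vx; apply/seteqP; split=> // q []. Qed.

Lemma rep_shres W (p : P W) : W `<=` V -> rep s p -> rep shres p.
Proof. by move=> WV [WU sp]; split=> // y Wy; rewrite shresE ?sp //; apply: WV. Qed.

End Restriction.

Lemma shres_presheaf : presheaf_axiom shres.
Proof.
split=> [U h s|U V W UV VW UW s]; apply: shsec_ext => x Wx; rewrite !shresE //.
exact: VW.
Qed.

Lemma shres_sheaf : sheaf_axiom shres.
Proof.
move=> U I V VU cov; split=> [s t st|s sE].
  apply: shsec_ext => x /cov[i Vx].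
  by rewrite -(shresE (VU i)) // st shresE.
have sij i j x : V i x -> V j x -> s i x = s j x.
  move=> Vix Vjx; have /(congr1 (fun f : shsec _ => f x)) := sE i j.
  by rewrite !shresE.
pose t x : set local_sec := [set r | exists i, V i x /\ s i x r].
have tE i x : V i x -> t x = s i x.
  move=> Vix; apply/seteqP; split=> [r [j [Vjx]]|r sr]; first by rewrite (sij j i).
  by exists i.
have tP : is_shsec U t.
  split=> [x nUx|x /cov[i Vix]].
    by apply/seteqP; split=> // r [i [Vix _]]; apply: nUx; apply: (VU i).
  have [W [p [Wx [WV sp]]]] := rep_ex (s i) Vix.
  exists W, p; split=> //; first exact: subset_trans WV (VU i).
  by move=> y Wy; rewrite (tE i) ?sp //; apply: WV.
exists (ShSec tP) => i; apply: shsec_ext => x Vx.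
by rewrite shresE //= (tE i).
Qed.

End Germ.

Arguments germ {X O P} x {V} p.

Section Lift2.
Variables (X : topologicalType) (O : ring_sheaf X).
Variables (P Q S : mod_presheaf O) (U : opens X).
Variable op : forall V : opens X, V `<=` U -> P V -> Q V -> S V.

Definition natural2 : Prop :=
  forall (V W : opens X) (VU : V `<=` U) (WU : W `<=` U) (WV : W `<=` V) p q,
  mres S WV (op VU p q) = op WU (mres P WV p) (mres Q WV q).

Hypothesis opN : natural2.

Definition shlift2_fun (s : shsec P U) (t : shsec Q U) (x : X) :
    set (local_sec S) :=
  [set r | exists (V : opens X) (VU : V `<=` U) (p : P V) (q : Q V),
    [/\ V x, s x = germ x p, t x = germ x q & germ x (op VU p q) r]].

Lemma shlift2_funE s t (V : opens X) (VU : V `<=` U) p q x :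
  V x -> rep s p -> rep t q -> shlift2_fun s t x = germ x (op VU p q).
Proof.
move=> Vx [_ sp] [_ tq]; apply/seteqP; split=> [r|r h]; last first.
  by exists V, VU, p, q; split; rewrite ?sp ?tq.
move=> [W [WU [p' [q' [Wx sp' tq']]]]].
suff -> : germ x (op WU p' q') = germ x (op VU p q) by [].
have /germP : germ x p' = germ x p by rewrite -sp' sp.
move=> /(_ Wx Vx) [Y [YW [YV [Yx ep]]]].
have /germP : germ x q' = germ x q by rewrite -tq' tq.
move=> /(_ Wx Vx) [Z [ZW [ZV [Zx eq]]]].
have hY : opensI Y Z `<=` Y by apply: subIsetl.
have hZ : opensI Y Z `<=` Z by apply: subIsetr.
have hW := subset_trans hY YW; have hV := subset_trans hY YV.
apply/germP => //; exists (opensI Y Z), hW, hV; split; first by split.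
rewrite (opN _ (subset_trans hV VU)) (opN _ (subset_trans hV VU)).
rewrite -(mres_comp YW hY) ep (mres_comp _ _ hV).
by rewrite -(mres_comp ZW hZ) eq (mres_comp _ _ hV).
Qed.

Fact shlift2_subproof s t : is_shsec U (shlift2_fun s t).
Proof.
split=> [x nUx|x Ux].
  apply/seteqP; split=> // r [V [VU [p [q [Vx]]]]].
  by case: nUx; apply: VU.
have [V [p [Vx sp]]] := rep_ex s Ux; have [W [q [Wx tq]]] := rep_ex t Ux.
have hV : opensI V W `<=` V by apply: subIsetl.
have hW : opensI V W `<=` W by apply: subIsetr.
have hU := subset_trans hV (proj1 sp).
exists (opensI V W), (op hU (mres P hV p) (mres Q hW q)); split=> // y yVW.
by apply: shlift2_funE => //; apply: rep_res.
Qed.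

Definition shlift2 s t : shsec S U := ShSec (shlift2_subproof s t).

Lemma rep_shlift2 s t (V : opens X) (VU : V `<=` U) p q :
  rep s p -> rep t q -> rep (shlift2 s t) (op VU p q).
Proof. by move=> sp tq; split=> // y Vy; apply: shlift2_funE. Qed.

End Lift2.

Section Lift1.
Variables (X : topologicalType) (O : ring_sheaf X).
Variables (P S : mod_presheaf O) (U : opens X).
Variable op : forall V : opens X, V `<=` U -> P V -> S V.

Definition natural1 : Prop :=
  forall (V W : opens X) (VU : V `<=` U) (WU : W `<=` U) (WV : W `<=` V) p,
  mres S WV (op VU p) = op WU (mres P WV p).

Hypothesis opN : natural1.

Fact natural1_2 : natural2 (fun V VU p (_ : P V) => op VU p).
Proof. by move=> V W VU WU WV p _; apply: opN. Qed.

Definition shlift1 (s : shsec P U) : shsec S U := shlift2 natural1_2 s s.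

Lemma rep_shlift1 s (V : opens X) (VU : V `<=` U) p :
  rep s p -> rep (shlift1 s) (op VU p).
Proof. by move=> sp; apply: (rep_shlift2 natural1_2 VU sp sp). Qed.

End Lift1.

Section Sheafification.
Variables (X : topologicalType) (O : ring_sheaf X) (P : mod_presheaf O).

Section Module.
Variable U : opens X.

Fact shadd_natural :
  natural2 (fun (V : opens X) (_ : V `<=` U) (p q : P V) => p + q).
Proof. by move=> V W _ _ WV p q; rewrite (semilinD (mres_lin P WV)). Qed.

Fact shscale_natural (a : O U) :
  natural1 (fun (V : opens X) (VU : V `<=` U) (p : P V) => rres O VU a *: p).
Proof.
move=> V W VU WU WV p; rewrite (semilinZ (mres_lin P WV)).
by have [_ h] := rresP O; rewrite (h _ _ _ VU WV WU).
Qed.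

Definition shzero : shsec P U := shunit (0 : P U).
Definition shadd : shsec P U -> shsec P U -> shsec P U := shlift2 shadd_natural.
Definition shscale (a : O U) : shsec P U -> shsec P U :=
  shlift1 (shscale_natural a).

Lemma rep_shzero (V : opens X) : V `<=` U -> rep shzero (0 : P V).
Proof.
by move=> h; have := rep_shunit (0 : P U) h; rewrite (semilin0 (mres_lin P h)).
Qed.

Lemma rep_shadd s t (V : opens X) (p q : P V) :
  rep s p -> rep t q -> rep (shadd s t) (p + q).
Proof. by move=> sp tq; apply: (rep_shlift2 shadd_natural (proj1 sp)). Qed.

Lemma rep_shscale a s (V : opens X) (VU : V `<=` U) (p : P V) :
  rep s p -> rep (shscale a s) (rres O VU a *: p).
Proof. exact: (rep_shlift1 (shscale_natural a) VU). Qed.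

Fact shaddA : associative shadd.
Proof.
move=> s t u; apply: shsec_eq => x Ux.
have [V [p [q [r [Vx sp tq ur]]]]] := rep_ex3 s t u Ux.
exists V, (p + (q + r)); split=> //; last rewrite addrA;
by do ?apply: rep_shadd.
Qed.

Fact shaddC : commutative shadd.
Proof.
move=> s t; apply: shsec_eq => x Ux.
have [V [p [q [Vx sp tq]]]] := rep_ex2 s t Ux.
by exists V, (p + q); split=> //; last rewrite addrC; apply: rep_shadd.
Qed.

Fact shadd0 : left_id shzero shadd.
Proof.
move=> s; apply: shsec_eq => x Ux; have [V [p [Vx sp]]] := rep_ex s Ux.
exists V, p; split=> //; rewrite -[p]add0r; apply: rep_shadd => //.
by apply: rep_shzero; case: sp.
Qed.

Fact shaddN : left_inverse shzero (shscale (-1)) shadd.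
Proof.
move=> s; apply: shsec_eq => x Ux; have [V [p [Vx sp]]] := rep_ex s Ux.
exists V, 0; split=> //; last by apply: rep_shzero; case: sp.
rewrite -(addNr p); apply: rep_shadd => //.
by rewrite -scaleN1r -(rmorphN1 (rres O (proj1 sp))); apply: rep_shscale.
Qed.

HB.instance Definition _ :=
  GRing.isZmodule.Build (shsec P U) shaddA shaddC shadd0 shaddN.

Fact shscaleA a b s : shscale a (shscale b s) = shscale (a * b) s.
Proof.
apply: shsec_eq => x Ux; have [V [p [Vx sp]]] := rep_ex s Ux.
exists V, (rres O (proj1 sp) (a * b) *: p); split=> //.
  by rewrite rmorphM -scalerA; do 2!apply: rep_shscale.
exact: rep_shscale.
Qed.

Fact shscale1 : left_id 1 shscale.
Proof.
move=> s; apply: shsec_eq => x Ux; have [V [p [Vx sp]]] := rep_ex s Ux.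
exists V, p; split=> //.
by have := rep_shscale 1 (proj1 sp) sp; rewrite rmorph1 scale1r.
Qed.

Fact shscaleDr : right_distributive shscale +%R.
Proof.
move=> a s t; apply: shsec_eq => x Ux.
have [V [p [q [Vx sp tq]]]] := rep_ex2 s t Ux.
exists V, (rres O (proj1 sp) a *: (p + q)); split=> //.
  by apply: rep_shscale; apply: rep_shadd.
by rewrite scalerDr; apply: rep_shadd; apply: rep_shscale.
Qed.

Fact shscaleDl s : {morph shscale^~ s : a b / a + b}.
Proof.
move=> a b; apply: shsec_eq => x Ux; have [V [p [Vx sp]]] := rep_ex s Ux.
exists V, (rres O (proj1 sp) (a + b) *: p); split=> //; first exact: rep_shscale.
by rewrite rmorphD scalerDl; apply: rep_shadd; apply: rep_shscale.
Qed.

HB.instance Definition _ := GRing.Zmodule_isLmodule.Build (O U) (shsec P U)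
  shscaleA shscale1 shscaleDr shscaleDl.

End Module.

Fact shres_lin (U V : opens X) (h : V `<=` U) :
  semilin (rres O h) (shres (P := P) h).
Proof.
move=> a s t; apply: shsec_eq => x Vx.
have [W [p [q [Wx sp tq]]]] := rep_ex2 s t (h x Vx).
have hW : opensI V W `<=` W by apply: subIsetr.
have hV : opensI V W `<=` V by apply: subIsetl.
have {}sp := rep_res hW sp; have {}tq := rep_res hW tq.
have hU := subset_trans hV h.
exists (opensI V W), (rres O hU a *: mres P hW p + mres P hW q); split=> //.
  apply: rep_shres => //; apply: rep_shadd => //.
  exact: rep_shscale.
apply: rep_shadd; last exact: rep_shres.
have [_ rc] := rresP O; rewrite -(rc _ _ _ h hV hU).
by apply: rep_shscale; apply: rep_shres.
Qed.

Definition sheafify : mod_sheaf O :=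
  ModSheaf (mpresheaf := ModPresheaf shres_lin (shres_presheaf P))
    (@shres_sheaf X O P).

End Sheafification.
Section TensorSheaves.
Variables (X : topologicalType) (O : ring_sheaf X) (F : mod_presheaf O).

Lemma rres_id (U : opens X) (h : U `<=` U) (a : O U) : rres O h a = a.
Proof. by have [h1 _] := rresP O; apply: h1. Qed.

Lemma rres_comp (U V W : opens X) (UV : V `<=` U) (VW : W `<=` V)
  (UW : W `<=` U) (a : O U) : rres O VW (rres O UV a) = rres O UW a.
Proof. by have [_ h2] := rresP O; apply: h2. Qed.

Definition T2res (U V : opens X) (h : V `<=` U) :
    tens (F U) (F U) -> tens (F V) (F V) :=
  tmap (rres O h) (mres F h).

Fact T2res_lin (U V : opens X) (h : V `<=` U) : semilin (rres O h) (T2res h).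
Proof. exact: tmap_lin (mres_lin F h). Qed.

Fact T2res_presheaf : presheaf_axiom T2res.
Proof.
split=> [U h|U V W UV VW UW].
  apply: (tens_eq (T2res_lin h)) => [a x y|x y]; first by rewrite rres_id.
  by rewrite /T2res (tmap_pure (mres_lin F h)) !mres_id.
apply: (tens_eq (rho := rres O UW)) => [a x y||x y].
- by rewrite !T2res_lin (rres_comp _ _ UW).
- exact: T2res_lin.
- rewrite /T2res (tmap_pure (mres_lin F UV)) (tmap_pure (mres_lin F VW)).
  by rewrite (tmap_pure (mres_lin F UW)) !(mres_comp _ _ UW).
Qed.

Definition T2pre : mod_presheaf O := ModPresheaf T2res_lin T2res_presheaf.

Definition Rres (k : nat) (U V : opens X) (h : V `<=` U) :
    Rpow (F U) k -> Rpow (F V) k :=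
  Rmap (rres O h) (mres F h) (k := k).

Fact Rres_lin k (U V : opens X) (h : V `<=` U) :
  semilin (rres O h) (@Rres k U V h).
Proof. exact: Rmap_lin (mres_lin F h) k. Qed.

Fact Rres_presheaf k : presheaf_axiom (@Rres k).
Proof.
split=> [U h|U V W UV VW UW].
  apply: (Rpow_eq (@Rres_lin k U U h)) => [a x y|w wk]; first by rewrite rres_id.
  rewrite /Rres (Rmap_word (mres_lin F h)) //; congr rword.
  by rewrite -[RHS]map_id; apply: eq_map => x; apply: mres_id.
apply: (Rpow_eq (rho := rres O UW)) => [a x y||w wk].
- by rewrite !Rres_lin (rres_comp _ _ UW).
- exact: Rres_lin.
- rewrite /Rres (Rmap_word (mres_lin F UV)) // (Rmap_word (mres_lin F VW)) ?size_map //.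
  rewrite (Rmap_word (mres_lin F UW)) // -map_comp; congr rword.
  by apply: eq_map => x; apply: mres_comp.
Qed.

Definition Rpre k : mod_presheaf O :=
  ModPresheaf (@Rres_lin k) (Rres_presheaf k).

(* The tensor operations are performed on sections over each open set and the *)
(* resulting presheaf is sheafified: the sheaf associated with                *)
(* U |-> S^k(F(U)) (x) F(U) is canonically S^k(F) (x) F = R^(k+1)(F).         *)
Definition T2sh : mod_sheaf O := sheafify T2pre.

Definition Rsh (k : nat) : mod_sheaf O := sheafify (Rpre k).

Section Operations.
Variable U : opens X.

Definition T2tens (m n : F U) : T2sh U := shunit (tpure m n : T2pre U).

Definition Rsh_of (m : F U) : Rsh 0 U := shunit (Rpow_of m : Rpre 0 U).

Fact T2sh_Rsh_natural : natural1 (P := T2pre) (S := Rpre 1)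
  (fun (V : opens X) (_ : V `<=` U) (x : T2pre V) => tens_Rpow x).
Proof. by move=> V W _ _ WV x; apply: Rmap_tens_Rpow (mres_lin F WV) x. Qed.

Definition T2sh_Rsh : T2sh U -> Rsh 1 U := shlift1 T2sh_Rsh_natural.

Fact Rshmul_natural a b :
  natural2 (P := Rpre a) (Q := Rpre b) (S := Rpre (a + b.+1))
    (fun (V : opens X) (_ : V `<=` U) (x : Rpre a V) (y : Rpre b V) => Rmul x y).
Proof. by move=> V W _ _ WV x y; exact (Rmap_mul (mres_lin F WV) x y). Qed.

Definition Rshmul a b : Rsh a U -> Rsh b U -> Rsh (a + b.+1) U :=
  shlift2 (@Rshmul_natural a b).

Definition Rshcast a b (e : a = b) (x : Rsh a U) : Rsh b U :=
  ecast k (Rsh k U) e x.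

Fact Rshswitch_natural k : natural1 (P := Rpre k) (S := Rpre k)
  (fun (V : opens X) (_ : V `<=` U) (x : Rpre k V) => switch x).
Proof. by move=> V W _ _ WV x; exact (Rmap_switch (mres_lin F WV) x). Qed.

Definition Rshswitch k : Rsh k U -> Rsh k U := shlift1 (@Rshswitch_natural k).

Definition Rshsigma k (x : Rsh k U) : Rsh k U := x + Rshswitch x.

End Operations.

(* The sections of K^(k+1)(F), the image sheaf of sigma^* on R^(k+1)(F).      *)
Definition Ksh (k : nat) (U : opens X) (s : Rsh k U) : Prop :=
  forall x, U x -> exists (V : opens X) (VU : V `<=` U),
    V x /\ exists t : Rsh k V, mres (Rsh k) VU s = Rshsigma t.

End TensorSheaves.

Section Connections.
Variables (X : topologicalType) (B : qalg_sheaf X) (O : alg_sheaf B).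

Record B_hom (F G : mod_sheaf O) := BHom {
  bhom_fun :> forall U : opens X, F U -> G U;
  bhom_res : forall (U V : opens X) (h : V `<=` U) (m : F U),
    mres G h (bhom_fun m) = bhom_fun (mres F h m);
  bhom_lin : forall (U : opens X) (b : B U) (m n : F U),
    bhom_fun (alg O b *: m + n) = alg O b *: bhom_fun m + bhom_fun n
}.

Record derivation (F : mod_sheaf O) := Derivation {
  der_fun :> forall U : opens X, O U -> F U;
  der_res : forall (U V : opens X) (h : V `<=` U) (a : O U),
    mres F h (der_fun a) = der_fun (rres O h a);
  der_lin : forall (U : opens X) (b : B U) (a c : O U),
    der_fun (alg O b * a + c) = alg O b *: der_fun a + der_fun c;
  der_leibniz : forall (U : opens X) (a c : O U),
    der_fun (a * c) = a *: der_fun c + c *: der_fun a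
}.

Variables (F : mod_sheaf O) (D : derivation F).

Record D_connection := DConnection {
  dconn :> B_hom F (T2sh F);
  dconnM : forall (U : opens X) (a : O U) (m : F U),
    dconn U (a *: m) = T2tens (D U a) m + a *: dconn U m
}.

(* K^2(F) is a subsheaf of T^2(F) through the identification [T2sh_Rsh].      *)
Definition D_flat (gamma : D_connection) : Prop :=
  forall (U : opens X) (a : O U), Ksh (T2sh_Rsh (gamma U (D U a))).

Definition D_integrable : Prop := exists gamma : D_connection, D_flat gamma.

Definition inv_succ (U : opens X) (j : nat) : O U := alg O (qalg B j.+1%:R^-1).

Fact ext_index i (j : 'I_i.+1) : (j + (i - j).+1)%N = i.+1.
Proof. by rewrite addnS subnKC // -ltnS. Qed.

(* T = (T_0, T_1, ...), with T_i : F -> R^(i+1)(F) = Rsh F i, and T_0 is the  *)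
(* identity under the identification [Rsh_of] of F with R^1(F). In the        *)
(* expansion of T_(i+1)(a m) the index j below is one less than in the        *)
(* formula                                                                    *)
(*   T_i(a m) = a T_i(m) + sum_(1 <= j <= i) 1/j T_(j-1)(D a) T_(i-j)(m).     *)
Record ext_connection := ExtConnection {
  econn :> forall i : nat, B_hom F (Rsh F i);
  econn0 : forall (U : opens X) (m : F U), econn 0%N U m = Rsh_of m;
  econnM : forall (i : nat) (U : opens X) (a : O U) (m : F U),
    econn i.+1 U (a *: m) = a *: econn i.+1 U m +
      \sum_(j < i.+1) inv_succ U j *:
        Rshcast (ext_index j) (Rshmul (econn j U (D U a)) (econn (i - j)%N U m))
}.

Definition ext_flat (T : ext_connection) : Prop :=
  forall (i : nat) (U : opens X) (a : O U), Ksh (T i U (D U a)).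

End Connections.

(* Main.v *)
From HB Require Import structures.
Require Import Defs.
From mathcomp Require Import all_boot all_order all_algebra.
From mathcomp Require Import zify ring.
From mathcomp Require Import boolp classical_sets topology_structure.

(** The proof is the calculus of the exponential map. View F as the sheaf of
one-forms on X and the local sections of the symmetric algebra S(F) as polynomial
functions on the tangent bundle. A connection gamma defines the geodesic vector
field on this bundle, which acts on S(F) as the derivation G extending D and gamma.
The exponential exp(G) applied to a function a is the Taylor series of a along
geodesics. Similarly, the Lie derivative L along the geodesic field acts on one-forms,
and T(m) is the vertical part of exp(L)(m), that is the pull-back of the one-form m
under the exponential map, restricted to the fibres of the tangent bundle. It
lies in S(F) (x) F, which is the part of positive degree of R(F).

All of this takes place in the part of positive degree of R(F), denoted R below.
A product x y only depends on y and on the class of x in S(F), so R is a module over S(F),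
freely generated by F ([free_ext]). Define

- G ([geod]), the derivation of R over D which is gamma on F;
- H = sigma^* G - G sigma^* ([hdiff]), the horizontal part of the differential,
  whereas sigma^* is its vertical part, polarization;
- C ([jacobi]), the S(F)-linear map which coincides with H G - G H on F.

If gamma is flat then H(D(a)) = G(D(a)) ([hdiff_der]); this is what makes H G - G H
linear over functions on F ([curvZ]), so that C exists, and then
H G - G H = C sigma^* on the whole of R, both sides being derivations ([curvE]).
The Lie derivative of a pair (h, v), with horizontal part h and vertical part v, is
(G h + C v, h + G v). Let (h_n, v_n) be its n-th iterate on (m, 0), and put
T_i(m) = v_(i+1) / (i+1)!.

The Leibniz formula for iterated derivations ([flowZ]) gives
T_i(a m) = a T_i(m) + sum_j g_j T_(i-j)(m) with g_j = G^(j-1)(D(a)) / j!. By induction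
from the two commutation relations above, the n-th iterate on (D(a), 0) is
(H x, sigma^* x) with x = G^(n-1)(D(a)) ([flow_der]), so T_(j-1)(D(a)) = sigma^*(g_j), which
is the flatness of T; and since sigma^*(g_j) acts by left multiplication as j g_j
([rmul_sigmal]), the Leibniz formula is the identity required of T.

The connection takes values in an associated sheaf, so none of this can be done
over one open set with honest tensors. The operators are defined on words over each open set, with
values in sheaves, and extended by [shbind]; identities are checked locally and on
products of letters ([Rsh_gen_ind]). *)

Set Implicit Arguments.
Unset Strict Implicit.
Unset Printing Implicit Defensive.

Import GRing.Theory.
Local Open Scope classical_set_scope.
Local Open Scope ring_scope.

(** * Words in R(M) *)

Section Words.
Variables (R : comPzRingType) (M : lmodType R).
Implicit Types (s t w : seq M) (m x : M).

(** The scalars can be absorbed in the last letter, so words generate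
additively. This is the form needed for maps which are additive without being
linear over the ring, such as the extensions of a connection. *)
Lemma Rpow_ind k (P : Rpow M k -> Prop) :
  P 0 -> (forall p q, P p -> P q -> P (p + q)) ->
  (forall w, size w = k.+1 -> P (rword k w)) -> forall p, P p.
Proof.
move=> P0 addP Pw; elim/pres_ind => // a [u m] p Pp.
apply: (addP _ _ _ Pp) => {p Pp}.
rewrite -[pgen _ _]/(tpure u m) -(semilinZ (rho := idfun) (tpure_linr u)).
move: (a *: m) => {a}m; elim/pres_ind: u => [|a v u Pu].
  by rewrite (semilin0 (rho := idfun) (tpure_linl m)).
rewrite tpure_linl; apply: (addP _ _ _ Pu) => {Pu}.
rewrite -(semilinZ (rho := idfun) (tpure_linr _)) -sword_tuple.
by rewrite -rword_rcons ?size_tuple //; apply: Pw; rewrite size_rcons size_tuple.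
Qed.

Lemma rword_perm k s t m : perm_eq s t ->
  size s = k -> rword k (rcons s m) = rword k (rcons t m).
Proof.
move=> st sk; rewrite !rword_rcons -?(perm_size st) //.
by congr (tpure _ _); apply: sword_perm.
Qed.

Lemma rword_lin k w : size w = k -> semilin idfun (fun x => rword k (x :: w)).
Proof.
case: k => [|k] wk a x y; first by rewrite /rword /= tpure_linr.
by rewrite /rword /= (sword_lin _ [::]) tpure_linl.
Qed.

(** The term m_1 ... m_n of sigma^* is the one in which the last letter
is moved last; the switch operator contributes the others. In this symmetric
form sigma^* is visibly the polarization S^n(M) -> S^(n-1)(M) (x) M. *)
Lemma sigma_word k w : size w = k.+1 ->
  rword k w + switch (rword k w) = \sum_(x <- w) rword k (rcons (rem x w) x).
Proof.
move=> wk; rewrite switch_word //.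
case/lastP: w wk => [//|s m]; rewrite size_rcons => -[sk].
rewrite switchwE //.
have rot : perm_eq (rcons s m) (m :: s) by rewrite perm_rcons.
have remE x : x \in m :: s -> perm_eq (rem x (m :: s)) (rem x (rcons s m)).
  move=> xs; rewrite -(perm_cons x) perm_sym.
  have xs' : x \in rcons s m by rewrite mem_rcons.
  apply: perm_trans (perm_to_rem xs); rewrite perm_sym.
  by rewrite (perm_trans _ (perm_to_rem xs')) // perm_sym.
rewrite (perm_big _ rot) /= big_cons; congr (_ + _).
  apply: rword_perm => //; apply: perm_trans (remE _ (mem_head _ _)).
  by rewrite /= eqxx.
apply: eq_big_seq => x xs; rewrite rword_rcons; last first.
  by rewrite size_rem ?size_rcons ?sk // mem_rcons inE xs orbT.
congr (tpure _ _); apply: sword_perm.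
have xms : x \in m :: s by rewrite inE xs orbT.
apply: perm_trans (remE _ xms).
rewrite /=; case: eqVneq => [->|_]; last exact: perm_refl.
by rewrite perm_sym perm_to_rem.
Qed.

End Words.

(** * Extension of maps from M to R(M) *)

Section Extension.
Variables (R : comPzRingType) (M : lmodType R).
Variables (Q : nat -> lmodType R) (phi : M -> Q 0%N).
Variable lam : forall k, M -> Q k -> Q k.+1.

(** The sum of the R^(k+1)(M), over k >= 0, is S(M) (x) M, the free module
on M over the symmetric algebra S(M). Hence a graded module Q with commuting
operators lam m, linear in m, receives a unique map from it which extends a
given phi on M and turns left multiplication by m into lam m. *)
Fixpoint word_ext k (w : seq M) : Q k :=
  match k with
  | 0 => phi (head 0 w)
  | k'.+1 => lam (head 0 w) (word_ext k' (behead w))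
  end.

Definition free_ext k (p : Rpow M k) : Q k :=
  tlift idfun
    (fun u m => slift idfun (fun s => word_ext k (rcons s m)) u) p.

Hypothesis phiL : semilin idfun phi.
Hypothesis lamLl : forall k z, semilin idfun (fun m => @lam k m z).
Hypothesis lamLr : forall k m, semilin idfun (@lam k m).
Hypothesis lamC : forall k m n z, lam m (@lam k n z) = lam n (lam m z).

(** Only a letter which is not the last one can be moved, since the last
letter is fed to phi. *)
Lemma word_ext_front k s x t : (size s <= k)%N ->
  word_ext k.+1 (s ++ x :: t) = word_ext k.+1 (x :: s ++ t).
Proof.
elim: s k => [//|y s IHs] [//|k] sk.
by rewrite -[LHS]/(lam y (word_ext k.+1 (s ++ x :: t))) IHs //= lamC.
Qed.

Lemma word_ext_perm k m s t : size s = k -> perm_eq s t ->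
  word_ext k (rcons s m) = word_ext k (rcons t m).
Proof.
elim: s k t => [|x s IHs] k t sk st.
  by move: st; rewrite perm_sym => /perm_nilP ->.
case: k sk => // k [sk].
have xt : x \in t by rewrite -(perm_mem st) mem_head.
case/splitPr: xt st => t1 t2 st.
have {}st : perm_eq s (t1 ++ t2).
  move: st; rewrite perm_sym perm_catC /= perm_cons perm_catC.
  by rewrite perm_sym.
rewrite rcons_cat rcons_cons word_ext_front; last first.
  by rewrite -sk (perm_size st) size_cat leq_addr.
by rewrite /= (IHs k (t1 ++ t2)) // rcons_cat.
Qed.

Lemma word_ext_lin k m s : (size s).+1 = k ->
  semilin idfun (fun x => word_ext k (rcons (x :: s) m)).
Proof. by case: k => // k _ a x y; rewrite /= lamLl. Qed.

Lemma word_ext_linr k s : size s = k -> semilin idfun (fun m => word_ext k (rcons s m)).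
Proof.
elim: s k => [|x s IHs] [|k] // sk a m n.
by rewrite /= IHs ?lamLr //; case: sk.
Qed.

Lemma extu_lin k m :
  semilin idfun (slift (n := k) idfun (fun s => word_ext k (rcons s m))).
Proof.
apply: slift_semilin => [s t|s sk]; first exact: word_ext_perm.
exact: word_ext_lin.
Qed.

Lemma extu_word k m s : size s = k ->
  slift idfun (fun s => word_ext k (rcons s m)) (sword k s) = word_ext k (rcons s m).
Proof.
move=> sk; apply: (slift_word (f := fun s => word_ext k (rcons s m))) sk.
  by move=> u v; apply: word_ext_perm.
by move=> u; apply: word_ext_lin.
Qed.

Lemma extu_linr k (u : sym k M) :
  semilin idfun (fun m => slift idfun (fun s => word_ext k (rcons s m)) u).
Proof.
move=> c m n; move: u; apply: (sym_eq (rho := idfun)).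
- exact: extu_lin.
- move=> d u u'; rewrite !extu_lin /= !scalerDr !scalerA mulrC -!addrA.
  by congr (_ + _); rewrite addrCA.
- by move=> s sk; rewrite !extu_word // word_ext_linr.
Qed.

Lemma free_ext_lin k : semilin idfun (@free_ext k).
Proof. by apply: tlift_semilin => [m|u]; [apply: extu_lin|apply: extu_linr]. Qed.

Lemma free_ext_word k w : size w = k.+1 -> free_ext (rword k w) = word_ext k w.
Proof.
case/lastP: w => [//|s m]; rewrite size_rcons => -[sk].
rewrite rword_rcons // -[RHS]extu_word //.
apply: (tlift_pure
  (f := fun u m => slift idfun (fun s => word_ext k (rcons s m)) u)) => [n|u].
  exact: extu_lin.
exact: extu_linr.
Qed.

Lemma free_ext_of m : free_ext (Rpow_of m) = phi m.
Proof. exact: free_ext_word. Qed.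

Lemma free_ext_mul k m (p : Rpow M k) : free_ext (Rmul (Rpow_of m) p) = lam m (free_ext p).
Proof.
move: p; apply: (Rpow_eq (rho := idfun)).
- by move=> a p q; rewrite Rmul_linr free_ext_lin.
- by move=> a p q; rewrite free_ext_lin lamLr.
move=> w wk; rewrite Rmul_word //.
by rewrite (free_ext_word (k := k.+1)) ?free_ext_word //= wk.
Qed.

End Extension.

(** Naturality in all the data at once. It makes the extensions performed over
each open set commute with restrictions. *)
Lemma free_ext_map (R S : comPzRingType) (rho : {rmorphism R -> S})
    (M : lmodType R) (N : lmodType S) (h : M -> N)
    (Q : nat -> lmodType R) (phi : M -> Q 0%N)
    (lam : forall k, M -> Q k -> Q k.+1)
    (Q' : nat -> lmodType S) (phi' : N -> Q' 0%N)
    (lam' : forall k, N -> Q' k -> Q' k.+1) (psi : forall k, Q k -> Q' k) :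
  semilin rho h ->
  semilin idfun phi -> (forall k z, semilin idfun (fun m => lam k m z)) ->
  (forall k m, semilin idfun (lam k m)) ->
  (forall k m n z, lam k.+1 m (lam k n z) = lam k.+1 n (lam k m z)) ->
  semilin idfun phi' -> (forall k z, semilin idfun (fun m => lam' k m z)) ->
  (forall k m, semilin idfun (lam' k m)) ->
  (forall k m n z, lam' k.+1 m (lam' k n z) = lam' k.+1 n (lam' k m z)) ->
  (forall k, semilin rho (psi k)) -> (forall m, psi 0%N (phi m) = phi' (h m)) ->
  (forall k m z, psi k.+1 (lam k m z) = lam' k (h m) (psi k z)) ->
  forall k p, psi k (free_ext phi lam p) = free_ext phi' lam' (Rmap rho h (k := k) p).
Proof.
move=> hL phiL lamLl lamLr lamC phiL' lamLl' lamLr' lamC' psiL psi0 psiS k.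
apply: (Rpow_eq (rho := rho)) => [a p q|a p q|w wk].
- by rewrite free_ext_lin ?psiL.
- by rewrite (Rmap_lin hL) free_ext_lin.
rewrite (Rmap_word hL) // !free_ext_word ?size_map //.
elim: k w wk => [|k IHk] [|x w] // [wk]; first exact: psi0.
by rewrite /= psiS IHk.
Qed.

(** * Sections of an associated sheaf *)

Section Local.
Variables (X : topologicalType) (O : ring_sheaf X) (P : mod_presheaf O).

Lemma sh_local (U : opens X) (s t : sheafify P U) :
  (forall x, U x -> exists (V : opens X) (VU : V `<=` U),
    V x /\ mres (sheafify P) VU s = mres (sheafify P) VU t) -> s = t.
Proof.
move=> h; apply: shsec_ext => x /h[V [VU [Vx st]]].
by rewrite -(shresE VU s Vx) -(shresE VU t Vx) -[shres VU s]/(mres (sheafify P) VU s) st.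
Qed.

Lemma sh_unit_ex (U : opens X) (s : sheafify P U) x : U x ->
  exists (V : opens X) (VU : V `<=` U) (p : P V),
    V x /\ mres (sheafify P) VU s = shunit p.
Proof.
move=> /(rep_ex s)[V [p [Vx [VU sp]]]]; exists V, VU, p; split=> //.
by apply: shsec_ext => y Vy; rewrite shresE //= sp.
Qed.

Lemma rep_unit (U : opens X) (p : P U) : rep (shunit p) p.
Proof. by split=> //; apply: subset_refl. Qed.

Lemma shunit_lin (U : opens X) : semilin idfun (@shunit X O P U : P U -> sheafify P U).
Proof.
move=> a p q; apply: shsec_eq => x Ux; exists U, (a *: p + q); split=> //.
  exact: rep_unit.
apply: rep_shadd; last exact: rep_unit.
rewrite -[a in rep _ (a *: _)](rres_id (@subset_refl _ U)).
by apply: rep_shscale; apply: rep_unit.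
Qed.

Lemma shunit_res (U V : opens X) (VU : V `<=` U) (p : P U) :
  mres (sheafify P) VU (shunit p) = shunit (mres P VU p).
Proof.
by apply: shsec_ext => y Vy; rewrite shresE //= germ_res.
Qed.

End Local.

Section Lifts.
Variables (X : topologicalType) (O : ring_sheaf X).
Variables (P Q S : mod_presheaf O) (op : forall V : opens X, P V -> Q V -> S V).
Hypothesis opN : forall U : opens X,
  natural2 (U := U) (fun (V : opens X) (_ : V `<=` U) => @op V).

Lemma shlift2_unit (U : opens X) (p : P U) (q : Q U) :
  shlift2 (@opN U) (shunit p) (shunit q) = shunit (op p q).
Proof.
apply: shsec_ext => x Ux.
have [_ ->//] := rep_shlift2 (@opN U) (@subset_refl _ U) (rep_unit p) (rep_unit q).
Qed.

Lemma shlift2_res (U V : opens X) (VU : V `<=` U)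
    (s : sheafify P U) (t : sheafify Q U) :
  mres (sheafify S) VU (shlift2 (@opN U) s t : sheafify S U) =
  shlift2 (@opN V) (mres (sheafify P) VU s) (mres (sheafify Q) VU t).
Proof.
apply: shsec_ext => x Vx; rewrite shresE //.
have [W [p [Wx sp]]] := rep_ex s (VU x Vx).
have [W' [q [W'x tq]]] := rep_ex t (VU x Vx).
pose Y := opensI V (opensI W W').
have YV : Y `<=` V by move=> y [].
have YW : Y `<=` W by move=> y [_ []].
have YW' : Y `<=` W' by move=> y [_ []].
have Yx : Y x by [].
have {}sp := rep_res YW sp; have {}tq := rep_res YW' tq.
have [_ -> //] := rep_shlift2 (@opN U) (subset_trans YV VU) sp tq.
by have [_ -> //] := rep_shlift2 (@opN V) YV (rep_shres VU YV sp) (rep_shres VU YV tq).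
Qed.

End Lifts.

Section Lifts1.
Variables (X : topologicalType) (O : ring_sheaf X).
Variables (P S : mod_presheaf O) (op : forall V : opens X, P V -> S V).
Hypothesis opN : forall U : opens X,
  natural1 (U := U) (fun (V : opens X) (_ : V `<=` U) => @op V).

Lemma shlift1_unit (U : opens X) (p : P U) :
  shlift1 (@opN U) (shunit p) = shunit (op p).
Proof.
apply: shsec_ext => x Ux.
by have [_ ->//] := rep_shlift1 (@opN U) (@subset_refl _ U) (rep_unit p).
Qed.

Lemma shlift1_res (U V : opens X) (VU : V `<=` U) (s : sheafify P U) :
  mres (sheafify S) VU (shlift1 (@opN U) s : sheafify S U) =
  shlift1 (@opN V) (mres (sheafify P) VU s).
Proof.
apply: shsec_ext => x Vx; rewrite shresE //.
have [W [p [Wx sp]]] := rep_ex s (VU x Vx).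
pose Y := opensI V W.
have YV : Y `<=` V by move=> y [].
have YW : Y `<=` W by move=> y [].
have {}sp := rep_res YW sp.
have [_ -> //] := rep_shlift1 (@opN U) (subset_trans YV VU) sp.
by have [_ -> //] := rep_shlift1 (@opN V) YV (rep_shres VU YV sp).
Qed.

End Lifts1.

Section Bind.
Variables (X : topologicalType) (O : ring_sheaf X) (P S : mod_presheaf O).
Variable op : forall V : opens X, P V -> sheafify S V.
Hypothesis opN : forall (U V : opens X) (VU : V `<=` U) p,
  mres (sheafify S) VU (op p) = op (mres P VU p).

(** A map of presheaves from P to a sheaf extends to the sheaf associated
with P. The connection sends a section of F to a section of an associated sheaf,
which is only locally a tensor, so operators built from it have this shape. *)
Definition shbind_fun (U : opens X) (s : shsec P U) (x : X) : set (local_sec S) :=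
  [set r | exists (V : opens X) (p : P V),
    [/\ V x, rep s p & (op p : shsec S V) x r]].

Lemma shbind_funE (U V : opens X) (s : shsec P U) (p : P V) x :
  V x -> rep s p -> shbind_fun s x = (op p : shsec S V) x.
Proof.
move=> Vx sp; apply/seteqP; split=> [r|r h]; last by exists V, p.
move=> [W [q [Wx sq]]].
have [Z [ZV [ZW [Zx e]]]] := rep_uniq Vx Wx sp sq.
rewrite -(shresE ZW (op q) Zx) -(shresE ZV (op p) Zx).
rewrite -[shres ZW _]/(mres (sheafify S) ZW _) -[shres ZV _]/(mres (sheafify S) ZV _).
by rewrite !opN e.
Qed.

Fact shbind_subproof (U : opens X) (s : shsec P U) : is_shsec U (shbind_fun s).
Proof.
split=> [x nUx|x Ux].
  by apply/seteqP; split=> // r [V [p [Vx [VU _] _]]]; apply: nUx; apply: VU.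
have [V [p [Vx sp]]] := rep_ex s Ux.
have [W [q [Wx [WV opq]]]] := rep_ex (op p) Vx.
exists W, q; split=> //; first exact: subset_trans WV (proj1 sp).
move=> y Wy; rewrite (shbind_funE _ sp); first exact: opq.
exact: WV.
Qed.

Definition shbind (U : opens X) (s : sheafify P U) : sheafify S U :=
  ShSec (shbind_subproof s).

Lemma shbind_unit (U : opens X) (p : P U) : shbind (shunit p) = op p.
Proof. by apply: shsec_ext => x Ux; rewrite /= (shbind_funE Ux (rep_unit p)). Qed.

Lemma shbind_res (U V : opens X) (VU : V `<=` U) (s : sheafify P U) :
  mres (sheafify S) VU (shbind s) = shbind (mres (sheafify P) VU s).
Proof.
apply: shsec_ext => x Vx; rewrite shresE //.
have [W [p [Wx sp]]] := rep_ex s (VU x Vx).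
pose Y := opensI V W.
have YV : Y `<=` V by move=> y [].
have YW : Y `<=` W by move=> y [].
have {}sp := rep_res YW sp.
have Yx : Y x by [].
by rewrite /= (shbind_funE Yx sp) (shbind_funE Yx (rep_shres VU YV sp)).
Qed.

End Bind.

(** * The graded algebra of sheaves R(F) *)

Section Graded.
Variables (X : topologicalType) (O : ring_sheaf X) (F : mod_presheaf O).
Implicit Types (U V : opens X).

Definition shword U k (w : seq (F U)) : Rsh F k U := shunit (rword k w : Rpre F k U).

Lemma Rsh_word_ind k (P : forall U, Rsh F k U -> Prop) :
  (forall U (s : Rsh F k U),
    (forall x, U x -> exists V (VU : V `<=` U), V x /\ P V (mres (Rsh F k) VU s)) ->
    P U s) ->
  (forall U, P U 0) -> (forall U s t, P U s -> P U t -> P U (s + t)) ->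
  (forall U w, size w = k.+1 -> P U (shword k w)) -> forall U s, P U s.
Proof.
move=> Pl P0 PD Pw U s; apply: Pl => x Ux.
have [V [VU [p [Vx sp]]]] := sh_unit_ex s Ux; exists V, VU; split=> //.
rewrite sp; elim/Rpow_ind: p {sp} => [|p q hp hq|w wk]; last exact: Pw.
- by rewrite (semilin0 (rho := idfun) (@shunit_lin _ _ _ V)).
- by rewrite (semilinD (rho := idfun) (@shunit_lin _ _ _ V)); apply: PD.
Qed.

Lemma Rsh_unit_ex2 U a b (s : Rsh F a U) (t : Rsh F b U) x : U x ->
  exists V (VU : V `<=` U) (p : Rpre F a V) (q : Rpre F b V),
    [/\ V x, mres (Rsh F a) VU s = shunit p & mres (Rsh F b) VU t = shunit q].
Proof.
move=> /(sh_unit_ex s)[V [VU [p [Vx sp]]]].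
have [W [WV [q [Wx tq]]]] := sh_unit_ex (mres (Rsh F b) VU t) Vx.
have WU := subset_trans WV VU.
exists W, WU, (mres (Rpre F a) WV p), q; split=> //.
  by rewrite -shunit_res -sp mres_comp.
by rewrite -tq mres_comp.
Qed.

Lemma Rsh_unit_ex3 U a b c (r : Rsh F a U) (s : Rsh F b U) (t : Rsh F c U) x :
  U x -> exists V (VU : V `<=` U) (n : Rpre F a V) (p : Rpre F b V) (q : Rpre F c V),
    [/\ V x, mres (Rsh F a) VU r = shunit n, mres (Rsh F b) VU s = shunit p
      & mres (Rsh F c) VU t = shunit q].
Proof.
move=> /(Rsh_unit_ex2 r s)[V [VU [n [p [Vx rn sp]]]]].
have [W [WV [q [Wx tq]]]] := sh_unit_ex (mres (Rsh F c) VU t) Vx.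
have WU := subset_trans WV VU.
exists W, WU, (mres (Rpre F a) WV n), (mres (Rpre F b) WV p), q; split=> //.
- by rewrite -shunit_res -rn mres_comp.
- by rewrite -shunit_res -sp mres_comp.
- by rewrite -tq mres_comp.
Qed.

Lemma Rshmul_unit U a b (p : Rpre F a U) (q : Rpre F b U) :
  Rshmul (shunit p) (shunit q) = shunit (Rmul p q : Rpre F (a + b.+1) U).
Proof. exact: (shlift2_unit (fun U => @Rshmul_natural _ _ F U a b) p q). Qed.

Lemma Rshmul_res U V (VU : V `<=` U) a b (x : Rsh F a U) (y : Rsh F b U) :
  mres (Rsh F _) VU (Rshmul x y) =
  Rshmul (mres (Rsh F a) VU x) (mres (Rsh F b) VU y).
Proof. exact: (shlift2_res (fun U => @Rshmul_natural _ _ F U a b)). Qed.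

Lemma Rshmul_linl U a b (y : Rsh F b U) :
  semilin idfun (fun x : Rsh F a U => Rshmul x y).
Proof.
move=> c x x'; apply: sh_local => z Uz.
have [V [VU [p [p' [q [Vz xp xp' yq]]]]]] := Rsh_unit_ex3 x x' y Uz.
exists V, VU; split=> //.
rewrite Rshmul_res !(mres_lin (Rsh F _)) !Rshmul_res xp xp' yq.
by rewrite -shunit_lin !Rshmul_unit -shunit_lin [in LHS]Rmul_linl.
Qed.

Lemma Rshmul_linr U a b (x : Rsh F a U) :
  semilin idfun (fun y : Rsh F b U => Rshmul x y).
Proof.
move=> c y y'; apply: sh_local => z Uz.
have [V [VU [p [q [q' [Vz xp yq yq']]]]]] := Rsh_unit_ex3 x y y' Uz.
exists V, VU; split=> //.
rewrite Rshmul_res !(mres_lin (Rsh F _)) !Rshmul_res xp yq yq'.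
by rewrite -shunit_lin !Rshmul_unit -shunit_lin [in LHS]Rmul_linr.
Qed.

Lemma Rshcast_id U a (x : Rsh F a U) : Rshcast erefl x = x.
Proof. by []. Qed.

(** The index n is free, so that the associativity and exchange laws and the
Leibniz rules below can be stated without transporting along equalities of degrees. The
value zero for mismatched degrees lets the bilinear rules hold without conditions. *)
Definition rmul n U a b (x : Rsh F a U) (y : Rsh F b U) : Rsh F n U :=
  if (a + b.+1)%N =P n is ReflectT e then Rshcast e (Rshmul x y) else 0.

Lemma rmulE n U a b (e : (a + b.+1 = n)%N) (x : Rsh F a U) (y : Rsh F b U) :
  rmul n x y = Rshcast e (Rshmul x y).
Proof.
by rewrite /rmul; case: eqP => // e'; rewrite (Prop_irrelevance e e').
Qed.

Lemma rmul_neq n U a b (x : Rsh F a U) (y : Rsh F b U) :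
  (a + b.+1 <> n)%N -> rmul n x y = 0.
Proof. by rewrite /rmul; case: eqP. Qed.

Lemma rmul_res n U V (VU : V `<=` U) a b (x : Rsh F a U) (y : Rsh F b U) :
  mres (Rsh F n) VU (rmul n x y) =
  rmul n (mres (Rsh F a) VU x) (mres (Rsh F b) VU y).
Proof.
have [e|ne] := eqVneq (a + b.+1)%N n; last first.
  by rewrite !rmul_neq ?(semilin0 (mres_lin (Rsh F n) VU)) //; apply/eqP.
by case: _ / e; rewrite !(rmulE erefl) !Rshcast_id Rshmul_res.
Qed.

Lemma rmul_linl n U a b (y : Rsh F b U) :
  semilin idfun (fun x : Rsh F a U => rmul n x y).
Proof.
move=> c x x'; have [e|ne] := eqVneq (a + b.+1)%N n; last first.
  by rewrite !rmul_neq ?scaler0 ?addr0 //; apply/eqP.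
by case: _ / e; rewrite !(rmulE erefl) !Rshcast_id Rshmul_linl.
Qed.

Lemma rmul_linr n U a b (x : Rsh F a U) :
  semilin idfun (fun y : Rsh F b U => rmul n x y).
Proof.
move=> c y y'; have [e|ne] := eqVneq (a + b.+1)%N n; last first.
  by rewrite !rmul_neq ?scaler0 ?addr0 //; apply/eqP.
by case: _ / e; rewrite !(rmulE erefl) !Rshcast_id Rshmul_linr.
Qed.

Section Rules.
Variables (n : nat) (U : opens X) (a b : nat).
Implicit Types (x : Rsh F a U) (y : Rsh F b U).
Lemma rmulDl x x' y : rmul n (x + x') y = rmul n x y + rmul n x' y.
Proof. exact: (semilinD (rmul_linl n y)). Qed.
Lemma rmulDr x y y' : rmul n x (y + y') = rmul n x y + rmul n x y'.
Proof. exact: (semilinD (rmul_linr n x)). Qed.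
Lemma rmulZl c x y : rmul n (c *: x) y = c *: rmul n x y.
Proof. exact: (semilinZ (rmul_linl n y)). Qed.
Lemma rmulZr c x y : rmul n x (c *: y) = c *: rmul n x y.
Proof. exact: (semilinZ (rmul_linr n x)). Qed.
Lemma rmul0l y : rmul n (0 : Rsh F a U) y = 0.
Proof. exact: (semilin0 (rmul_linl n y)). Qed.
Lemma rmul0r x : rmul n x (0 : Rsh F b U) = 0.
Proof. exact: (semilin0 (rmul_linr n x)). Qed.
Lemma rmulBr x y y' : rmul n x (y - y') = rmul n x y - rmul n x y'.
Proof. by rewrite -scaleN1r rmulDr rmulZr scaleN1r. Qed.
Lemma rmul_suml (I : Type) (r : seq I) (f : I -> Rsh F a U) y :
  rmul n (\sum_(i <- r) f i) y = \sum_(i <- r) rmul n (f i) y.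
Proof. exact: (semilin_sum _ _ _ (rmul_linl n y)). Qed.
Lemma rmul_sumr (I : Type) (r : seq I) (f : I -> Rsh F b U) x :
  rmul n x (\sum_(i <- r) f i) = \sum_(i <- r) rmul n x (f i).
Proof. exact: (semilin_sum _ _ _ (rmul_linr n x)). Qed.
End Rules.

Lemma rmul_word n U a b (s t : seq (F U)) :
  size s = a.+1 -> size t = b.+1 -> (a + b.+1 = n)%N ->
  rmul n (shword a s) (shword b t) = shword n (s ++ t).
Proof.
move=> sa tb e; case: _ / e; rewrite (rmulE erefl) !Rshcast_id Rshmul_unit.
by rewrite /shword -Rmul_word.
Qed.

Lemma shword_perm k U (s t : seq (F U)) m : perm_eq s t ->
  size s = k -> shword k (rcons s m) = shword k (rcons t m).
Proof. by move=> st sk; rewrite /shword (rword_perm _ st sk). Qed.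

End Graded.

Lemma semilinMn (R S : comPzRingType) (rho : {rmorphism R -> S})
    (M : lmodType R) (N : lmodType S) (f : M -> N) (x : M) i :
  semilin rho f -> f (x *+ i) = f x *+ i.
Proof.
move=> fL; elim: i => [|i IHi]; first by rewrite !mulr0n (semilin0 fL).
by rewrite !mulrS (semilinD fL) IHi.
Qed.

Section Laws.
Variables (X : topologicalType) (O : ring_sheaf X) (F : mod_presheaf O).
Implicit Types (U V : opens X).

Lemma Rsh_local k U (s t : Rsh F k U) :
  (forall x, U x -> exists V (VU : V `<=` U),
    V x /\ mres (Rsh F k) VU s = mres (Rsh F k) VU t) -> s = t.
Proof. exact: sh_local. Qed.

(** The inductions below are applied to identities between additive maps, and
this is what they require in each variable. *)
Definition add_closed (M : zmodType) (P : M -> Prop) :=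
  P 0 /\ forall s t, P s -> P t -> P (s + t).

Lemma shunit_ind k U (P : Rsh F k U -> Prop) :
  add_closed P -> (forall w, size w = k.+1 -> P (shword k w)) ->
  forall p : Rpre F k U, P (shunit p).
Proof.
move=> [P0 PD] Pw; have uL := @shunit_lin _ _ (Rpre F k) U.
elim/Rpow_ind => [|p q hp hq|w wk]; last exact: Pw.
- by rewrite (semilin0 (rho := idfun) uL).
- by rewrite (semilinD (rho := idfun) uL); apply: PD.
Qed.

Lemma Rsh_word_ind2 a b (P : forall U, Rsh F a U -> Rsh F b U -> Prop) :
  (forall U r s, (forall x, U x -> exists V (VU : V `<=` U), V x /\
    P V (mres (Rsh F a) VU r) (mres (Rsh F b) VU s)) -> P U r s) ->
  (forall U s, add_closed (fun r => P U r s)) ->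
  (forall U r, add_closed (fun s => P U r s)) ->
  (forall U u v, size u = a.+1 -> size v = b.+1 ->
    P U (shword a u) (shword b v)) -> forall U r s, P U r s.
Proof.
move=> Pl Pr Ps Pw U r s; apply: Pl => x Ux.
have [V [VU [p [q [Vx rp sq]]]]] := Rsh_unit_ex2 r s Ux.
exists V, VU; split=> //; rewrite {}rp {}sq.
apply: (shunit_ind (P := fun r => P V r (shunit q))) p => // u ua.
by apply: (shunit_ind (P := fun s => P V (shword a u) s)) q => // v vb; apply: Pw.
Qed.

Lemma Rsh_word_ind3 a b c
    (P : forall U, Rsh F a U -> Rsh F b U -> Rsh F c U -> Prop) :
  (forall U r s t, (forall x, U x -> exists V (VU : V `<=` U), V x /\
    P V (mres (Rsh F a) VU r) (mres (Rsh F b) VU s) (mres (Rsh F c) VU t)) ->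
    P U r s t) ->
  (forall U s t, add_closed (fun r => P U r s t)) ->
  (forall U r t, add_closed (fun s => P U r s t)) ->
  (forall U r s, add_closed (fun t => P U r s t)) ->
  (forall U u v w, size u = a.+1 -> size v = b.+1 -> size w = c.+1 ->
    P U (shword a u) (shword b v) (shword c w)) -> forall U r s t, P U r s t.
Proof.
move=> Pl Pr Ps Pt Pw U r s t; apply: Pl => x Ux.
have [V [VU [n [p [q [Vx rn sp tq]]]]]] := Rsh_unit_ex3 r s t Ux.
exists V, VU; split=> //; rewrite {}rn {}sp {}tq.
apply: (shunit_ind (P := fun r => P V r (shunit p) (shunit q))) n => // u ua.
apply: (shunit_ind (P := fun s => P V (shword a u) s (shunit q))) p => // v vb.
apply: (shunit_ind (P := fun t => P V (shword a u) (shword b v) t)) q => // w wc.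
exact: Pw.
Qed.

Lemma rmulA n k l U a b c (x : Rsh F a U) (y : Rsh F b U) (z : Rsh F c U) :
  (a + b.+1 = k)%N -> (b + c.+1 = l)%N ->
  rmul n (rmul k x y) z = rmul n x (rmul l y z).
Proof.
move=> ek el; have [en|ne] := eqVneq (k + c.+1)%N n; last first.
  by rewrite !rmul_neq //; lia.
apply: (Rsh_word_ind3 (P := fun U (x : Rsh F a U) (y : Rsh F b U) (z : Rsh F c U) =>
  rmul n (rmul k x y) z = rmul n x (rmul l y z))).
- move=> {x y z}U x y z h; apply: Rsh_local => u /h[V [VU [Vu hV]]].
  by exists V, VU; rewrite !rmul_res hV.
- by move=> V s t; split=> [|r r' h h']; rewrite ?rmul0l // !rmulDl h h'.
- by move=> V s t; split=> [|r r' h h']; rewrite ?(rmul0l, rmul0r) // !(rmulDl, rmulDr) h h'.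
- by move=> V s t; split=> [|r r' h h']; rewrite ?rmul0r // !rmulDr h h'.
move=> V u v w ua vb wc; rewrite !rmul_word ?catA ?size_cat ?ua ?vb ?wc //.
all: lia.
Qed.

(** All letters but the last commute, and the last letter of
x y z is the last letter of z. *)
Lemma rmulCA n k l U a b c (x : Rsh F a U) (y : Rsh F b U) (z : Rsh F c U) :
  (b + c.+1 = k)%N -> (a + c.+1 = l)%N ->
  rmul n x (rmul k y z) = rmul n y (rmul l x z).
Proof.
move=> ek el; have [en|ne] := eqVneq (a + k.+1)%N n; last first.
  by rewrite !rmul_neq //; lia.
apply: (Rsh_word_ind3 (P := fun U (x : Rsh F a U) (y : Rsh F b U) (z : Rsh F c U) =>
  rmul n x (rmul k y z) = rmul n y (rmul l x z))).
- move=> {x y z}U x y z h; apply: Rsh_local => u /h[V [VU [Vu hV]]].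
  by exists V, VU; rewrite !rmul_res hV.
- by move=> V s t; split=> [|r r' h h']; rewrite ?(rmul0l, rmul0r) // !(rmulDl, rmulDr) h h'.
- by move=> V s t; split=> [|r r' h h']; rewrite ?(rmul0l, rmul0r) // !(rmulDl, rmulDr) h h'.
- by move=> V s t; split=> [|r r' h h']; rewrite ?rmul0r // !rmulDr h h'.
move=> V u v w ua vb wc; rewrite !rmul_word ?size_cat ?ua ?vb ?wc //.
  case/lastP: w wc => [//|w m]; rewrite size_rcons => -[wc].
  rewrite -!rcons_cat; apply: shword_perm; first by rewrite perm_catCA.
  by rewrite !size_cat ua vb wc; lia.
all: lia.
Qed.

Lemma Rshswitch_res k U V (VU : V `<=` U) (x : Rsh F k U) :
  mres (Rsh F k) VU (Rshswitch x) = Rshswitch (mres (Rsh F k) VU x).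
Proof. exact: (shlift1_res (fun U => @Rshswitch_natural _ _ F U k)). Qed.

Lemma Rshswitch_unit k U (p : Rpre F k U) :
  Rshswitch (shunit p) = shunit (switch p : Rpre F k U).
Proof. exact: (shlift1_unit (fun U => @Rshswitch_natural _ _ F U k)). Qed.

Lemma Rshswitch_lin k U : semilin idfun (@Rshswitch _ _ F U k).
Proof.
move=> c x x'; apply: sh_local => z Uz.
have [V [VU [p [q [Vz xp xq]]]]] := Rsh_unit_ex2 x x' Uz.
exists V, VU; split=> //.
rewrite Rshswitch_res !(mres_lin (Rsh F _)) !Rshswitch_res xp xq.
by rewrite -shunit_lin !Rshswitch_unit -shunit_lin [in LHS]switch_lin.
Qed.

Lemma Rshsigma_res k U V (VU : V `<=` U) (x : Rsh F k U) :
  mres (Rsh F k) VU (Rshsigma x) = Rshsigma (mres (Rsh F k) VU x).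
Proof. by rewrite (semilinD (mres_lin (Rsh F k) VU)) Rshswitch_res. Qed.

Lemma Rshsigma_lin k U : semilin idfun (@Rshsigma _ _ F U k).
Proof.
by move=> c x y; rewrite /Rshsigma Rshswitch_lin scalerDr addrACA.
Qed.

Lemma RshsigmaD k U (x y : Rsh F k U) :
  Rshsigma (x + y) = Rshsigma x + Rshsigma y.
Proof. exact: (semilinD (@Rshsigma_lin k U)). Qed.
Lemma RshsigmaZ k U c (x : Rsh F k U) : Rshsigma (c *: x) = c *: Rshsigma x.
Proof. exact: (semilinZ (@Rshsigma_lin k U)). Qed.
Lemma Rshsigma0 k U : Rshsigma (0 : Rsh F k U) = 0.
Proof. exact: (semilin0 (@Rshsigma_lin k U)). Qed.

Lemma Rshsigma_word k U (w : seq (F U)) : size w = k.+1 ->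
  Rshsigma (shword k w) = \sum_(x <- w) shword k (rcons (rem x w) x).
Proof.
move=> wk; rewrite /Rshsigma Rshswitch_unit.
rewrite -(semilinD (rho := idfun) (@shunit_lin _ _ (Rpre F k) U)) sigma_word //.
exact: (semilin_sum _ _ _ (@shunit_lin _ _ (Rpre F k) U)).
Qed.

Lemma RshsigmaE k U (x : Rsh F k U) : Rshsigma x = x + Rshswitch x.
Proof. by []. Qed.

Lemma Rshswitch_invol U (x : Rsh F 1 U) : Rshswitch (Rshswitch x) = x.
Proof.
move: U x; apply: Rsh_word_ind => [U x h|U|U x y h h'|U w].
- by apply: Rsh_local => u /h[V [VU [Vu hV]]]; exists V, VU; rewrite !Rshswitch_res hV.
- by rewrite !(semilin0 (@Rshswitch_lin 1 U)).
- by rewrite !(semilinD (@Rshswitch_lin 1 U)) h h'.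
case: w => [|m [|n [|//]]] // _.
by rewrite !Rshswitch_unit switch_word // /switchw big_nat1 /= switch_word // /switchw big_nat1.
Qed.

Lemma Rshsigma_of U (m : F U) : Rshsigma (Rsh_of m) = Rsh_of m.
Proof.
by rewrite -[Rsh_of m]/(shword 0 [:: m]) Rshsigma_word // big_seq1 /= eqxx.
Qed.

Lemma rem_catl (T : eqType) (x : T) (u v : seq T) : x \in u ->
  rem x (u ++ v) = rem x u ++ v.
Proof.
by elim: u => //= y u IHu; rewrite inE eq_sym; case: eqVneq => //= _ /IHu ->.
Qed.

Lemma rem_catr (T : eqType) (x : T) (u v : seq T) : x \in v ->
  perm_eq (rem x (u ++ v)) (u ++ rem x v).
Proof.
move=> xv; rewrite -(perm_cons x).
have xuv : x \in u ++ v by rewrite mem_cat xv orbT.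
rewrite perm_sym; apply: perm_trans (perm_to_rem xuv).
rewrite -cat1s perm_catCA perm_cat2l perm_sym; exact: perm_to_rem.
Qed.

(** Polarization is a derivation: the letter which sigma^* moves to
the end comes either from y or from x, and in the second case all of y passes to
the left, where the order is irrelevant. *)
Lemma Rshsigma_mul n U a b (x : Rsh F a U) (y : Rsh F b U) :
  (a + b.+1 = n)%N ->
  Rshsigma (rmul n x y) = rmul n x (Rshsigma y) + rmul n y (Rshsigma x).
Proof.
move=> en; apply: (Rsh_word_ind2 (P := fun U (x : Rsh F a U) (y : Rsh F b U) =>
  Rshsigma (rmul n x y) = rmul n x (Rshsigma y) + rmul n y (Rshsigma x))).
- move=> {x y}U x y h; apply: Rsh_local => u /h[V [VU [Vu hV]]].
  exists V, VU; split=> //; rewrite (semilinD (mres_lin (Rsh F n) VU)).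
  by rewrite !(rmul_res, Rshsigma_res) hV.
- move=> V s; split=> [|r r' h h'].
    by rewrite !(rmul0l, rmul0r, Rshsigma0) ?rmul0r addr0.
  rewrite RshsigmaD !rmulDl RshsigmaD (rmulDr n s (Rshsigma r)).
  by rewrite h h' addrACA.
- move=> V s; split=> [|r r' h h'].
    by rewrite !(rmul0l, rmul0r, Rshsigma0) ?rmul0r addr0.
  rewrite RshsigmaD !rmulDl (rmulDr n s r) RshsigmaD (rmulDr n s (Rshsigma r)).
  by rewrite h h' addrACA.
move=> V u v ua vb.
have en' : (b + a.+1 = n)%N by lia.
rewrite rmul_word // !Rshsigma_word ?size_cat ?ua ?vb -?en ?addSn //.
rewrite big_cat /= addrC !rmul_sumr; congr (_ + _); apply: eq_big_seq => z zu.
  rewrite rmul_word ?size_rcons ?size_rem ?vb ?ua // -rcons_cat.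
  apply: shword_perm; first exact: rem_catr.
  by rewrite size_rem ?size_cat ?ua ?vb ?mem_cat ?zu ?orbT //= addnS.
rewrite rmul_word ?size_rcons ?size_rem ?vb ?ua ?en // -rcons_cat.
rewrite rem_catl //; apply: shword_perm; first by rewrite perm_catC.
by rewrite size_cat size_rem // ua vb -en.
Qed.

(** Left multiplication only sees the class in the symmetric algebra, where the
a + 1 terms of sigma^*(x) agree with x. *)
Lemma rmul_sigmal n U a b (x : Rsh F a U) (y : Rsh F b U) :
  rmul n (Rshsigma x) y = rmul n x y *+ a.+1.
Proof.
have [en|ne] := eqVneq (a + b.+1)%N n; last first.
  by rewrite !rmul_neq ?mul0rn //; apply/eqP.
apply: (Rsh_word_ind2 (P := fun U (x : Rsh F a U) (y : Rsh F b U) =>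
  rmul n (Rshsigma x) y = rmul n x y *+ a.+1)).
- move=> {x y}U x y h; apply: Rsh_local => u /h[V [VU [Vu hV]]].
  exists V, VU; split=> //; rewrite (semilinMn _ _ (mres_lin (Rsh F n) VU)).
  by rewrite !(rmul_res, Rshsigma_res) hV.
- move=> V s; split=> [|r r' h h'].
    by rewrite Rshsigma0 rmul0l mul0rn.
  by rewrite RshsigmaD (rmulDl n r) (rmulDl n (Rshsigma r)) h h' mulrnDl.
- move=> V s; split=> [|r r' h h'].
    by rewrite !rmul0r mul0rn.
  by rewrite (rmulDr n (Rshsigma s)) (rmulDr n s) h h' mulrnDl.
move=> V u v ua vb.
rewrite rmul_word // !Rshsigma_word // rmul_suml -ua -[size u]subn0 -sumr_const_nat.
rewrite (big_nth 0); apply: eq_big_nat => i /andP[_ iu].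
move: (mem_nth 0 iu) => /=; move: (nth 0 u i) => z zu.
case/lastP: v vb => [//|v m]; rewrite size_rcons => -[vb].
rewrite rmul_word ?size_rcons ?size_rem ?vb ?ua // -!rcons_cat.
apply: shword_perm; last by rewrite size_cat size_rcons size_rem // ua vb -en addnS.
by rewrite perm_cat2r perm_rcons perm_sym perm_to_rem.
Qed.

(** Locally every section is a sum of products of sections of F, so an
identity between local additive operators can be checked by multiplying on the left by
one letter at a time. *)
Lemma Rsh_gen_ind (P : forall k U, Rsh F k U -> Prop) :
  (forall k U (s : Rsh F k U), (forall x, U x -> exists V (VU : V `<=` U),
    V x /\ P k V (mres (Rsh F k) VU s)) -> P k U s) ->
  (forall k U, add_closed (P k U)) ->
  (forall U m, P 0%N U (Rsh_of m)) ->
  (forall k U m z, P k U z -> P k.+1 U (rmul k.+1 (Rsh_of m) z)) ->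
  forall k U s, P k U s.
Proof.
move=> Pl PD P0 PS k; apply: Rsh_word_ind => [U s|U|U|U w].
- exact: Pl.
- by case: (PD k U).
- by case: (PD k U).
elim: k w => [|k IHk] [//|m w] [wk].
  by case: w wk => // _; apply: P0.
by rewrite -[m :: w]cat1s -(rmul_word (a := 0) (b := k)) //; apply/PS/IHk.
Qed.

End Laws.

(** * Sections of F as elements of degree one *)

Section Letters.
Variables (X : topologicalType) (O : ring_sheaf X) (F : mod_presheaf O).
Implicit Types (U V : opens X).

Lemma Rsh_of_lin U : semilin idfun (@Rsh_of _ _ F U).
Proof.
move=> a m n; rewrite /Rsh_of /Rpow_of (rword_lin (k := 0) (w := [::])) //.
exact: (@shunit_lin _ _ (Rpre F 0) U).
Qed.

Lemma Rsh_ofD U (m n : F U) : Rsh_of (m + n) = Rsh_of m + Rsh_of n.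
Proof. exact: (semilinD (rho := idfun) (@Rsh_of_lin U)). Qed.

Lemma Rsh_ofZ U a (m : F U) : Rsh_of (a *: m) = a *: Rsh_of m.
Proof. exact: (semilinZ (rho := idfun) (@Rsh_of_lin U)). Qed.

Lemma Rsh_of0 U : Rsh_of (0 : F U) = 0.
Proof. exact: (semilin0 (rho := idfun) (@Rsh_of_lin U)). Qed.

Lemma Rsh_of_res U V (VU : V `<=` U) (m : F U) :
  mres (Rsh F 0) VU (Rsh_of m) = Rsh_of (mres F VU m).
Proof.
rewrite (shunit_res (P := Rpre F 0)) /Rsh_of; congr shunit.
by rewrite /= /Rres (Rmap_word (mres_lin F VU)).
Qed.

Lemma T2sh_Rsh_res U V (VU : V `<=` U) (t : T2sh F U) :
  mres (Rsh F 1) VU (T2sh_Rsh t) = T2sh_Rsh (mres (T2sh F) VU t).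
Proof. exact: (shlift1_res (fun U => @T2sh_Rsh_natural _ _ F U)). Qed.

Lemma T2sh_Rsh_unit U (p : T2pre F U) :
  T2sh_Rsh (shunit p) = shunit (tens_Rpow p : Rpre F 1 U).
Proof. exact: (shlift1_unit (fun U => @T2sh_Rsh_natural _ _ F U)). Qed.

Lemma T2sh_Rsh_lin U : semilin idfun (@T2sh_Rsh _ _ F U).
Proof.
move=> c x y; apply: sh_local => z Uz.
have [V [VU [p [Vz xp]]]] := sh_unit_ex x Uz.
have [W [WV [q [Wz yq]]]] := sh_unit_ex (mres (T2sh F) VU y) Vz.
have WU := subset_trans WV VU.
exists W, WU; split=> //.
have {}xp : mres (T2sh F) WU x = shunit (mres (T2pre F) WV p).
  by rewrite -shunit_res -xp mres_comp.
have {}yq : mres (T2sh F) WU y = shunit q by rewrite -yq mres_comp.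
rewrite T2sh_Rsh_res (mres_lin (T2sh F)) (mres_lin (Rsh F 1)) !T2sh_Rsh_res xp yq.
by rewrite -shunit_lin !T2sh_Rsh_unit -shunit_lin [in LHS]tens_Rpow_lin.
Qed.

Lemma T2sh_Rsh_tens U (m n : F U) :
  T2sh_Rsh (T2tens m n) = rmul 1 (Rsh_of m) (Rsh_of n).
Proof.
rewrite (rmul_word (s := [:: m]) (t := [:: n])) //.
by rewrite T2sh_Rsh_unit tens_Rpow_pure.
Qed.

End Letters.

(** * The geodesic derivation *)

Section Operators.
Variables (X : topologicalType) (B : qalg_sheaf X) (O : alg_sheaf B).
Variables (F : mod_sheaf O) (D : derivation F) (gamma : D_connection D).
Implicit Types (U V : opens X).

Lemma derD U (a c : O U) : D U (a + c) = D U a + D U c.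
Proof. by have := der_lin D 1 a c; rewrite rmorph1 mul1r scale1r. Qed.

Lemma der0 U : D U 0 = 0.
Proof. by apply: (addrI (D U 0)); rewrite -derD !addr0. Qed.

Lemma der1 U : D U 1 = 0.
Proof.
by apply: (addrI (D U 1)); rewrite addr0 -{3}[1]mulr1 der_leibniz !scale1r.
Qed.

Lemma der_alg U (b : B U) : D U (alg O b) = 0.
Proof. by have := der_lin D b 1 0; rewrite mulr1 addr0 der0 der1 scaler0 addr0. Qed.

Definition gammaR U (m : F U) : Rsh F 1 U := T2sh_Rsh (gamma U m).

Lemma gammaRD U (m n : F U) : gammaR (m + n) = gammaR m + gammaR n.
Proof.
rewrite /gammaR; have := bhom_lin gamma 1 m n; rewrite rmorph1 !scale1r => ->.
exact: (semilinD (rho := idfun) (@T2sh_Rsh_lin _ _ F U)).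
Qed.

Lemma gammaRZ U (a : O U) (m : F U) :
  gammaR (a *: m) = a *: gammaR m + rmul 1 (Rsh_of (D U a)) (Rsh_of m).
Proof.
rewrite /gammaR dconnM addrC T2sh_Rsh_lin; congr (_ + _).
exact: T2sh_Rsh_tens.
Qed.

Lemma gammaR_res U V (VU : V `<=` U) (m : F U) :
  mres (Rsh F 1) VU (gammaR m) = gammaR (mres F VU m).
Proof. by rewrite /gammaR T2sh_Rsh_res bhom_res. Qed.

Section Jets.
Variables (k : nat) (U : opens X).

(** Pairs (z, w) which behave like a section and its image under a derivation
over D: the scalar a acts by (a z, a w + D(a) z). A map which is not linear but
satisfies the Leibniz rule becomes linear when it is completed by the
identity to a map to jets, so that the universal property of R(F) applies to it. *)
Definition jet : Type := (Rsh F k U * Rsh F k.+1 U)%type.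

HB.instance Definition _ := GRing.Zmodule.on jet.

Definition jet_scale (a : O U) (z : jet) : jet :=
  (a *: z.1, a *: z.2 + rmul k.+1 (Rsh_of (D U a)) z.1).

Fact jet_scaleA a b z : jet_scale a (jet_scale b z) = jet_scale (a * b) z.
Proof.
case: z => x y; congr (_, _) => /=; first by rewrite scalerA.
rewrite der_leibniz Rsh_ofD !Rsh_ofZ rmulDl !rmulZl rmulZr.
by rewrite scalerDr scalerA addrA.
Qed.

Fact jet_scale1 : left_id 1 jet_scale.
Proof.
case=> x y; congr (_, _) => /=; first by rewrite scale1r.
by rewrite der1 Rsh_of0 rmul0l scale1r addr0.
Qed.

Fact jet_scaleDr : right_distributive jet_scale +%R.
Proof.
move=> a [x y] [x' y']; congr (_, _) => /=; first by rewrite scalerDr.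
by rewrite scalerDr rmulDr addrACA.
Qed.

Fact jet_scaleDl z : {morph jet_scale^~ z : a b / a + b}.
Proof.
case: z => x y a b; congr (_, _) => /=; first by rewrite scalerDl.
by rewrite scalerDl derD Rsh_ofD rmulDl addrACA.
Qed.

HB.instance Definition _ := GRing.Zmodule_isLmodule.Build (O U) jet
  jet_scaleA jet_scale1 jet_scaleDr jet_scaleDl.

End Jets.

Definition jet_of U (m : F U) : jet 0 U := (Rsh_of m, gammaR m).

(** The Leibniz rule for the product m z, read on pairs. *)
Definition jet_mul U k (m : F U) (z : jet k U) : jet k.+1 U :=
  (rmul k.+1 (Rsh_of m) z.1,
   rmul k.+2 (Rsh_of m) z.2 + rmul k.+2 (gammaR m) z.1).

Lemma jet_of_lin U : semilin idfun (@jet_of U).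
Proof.
move=> a m n; congr (_, _); first by rewrite Rsh_ofD Rsh_ofZ.
by rewrite gammaRD gammaRZ.
Qed.

Lemma jet_mul_linl U k z : semilin idfun (fun m => @jet_mul U k m z).
Proof.
move=> a m n; case: z => x y; congr (_, _) => /=.
  by rewrite Rsh_ofD Rsh_ofZ rmulDl rmulZl.
rewrite Rsh_ofD Rsh_ofZ gammaRD gammaRZ !rmulDl !rmulZl.
rewrite (rmulA k.+2 (l := k.+1)) // scalerDr addrACA.
by congr (_ + _); rewrite addrA.
Qed.

Lemma jet_mul_linr U k m : semilin idfun (@jet_mul U k m).
Proof.
move=> a [x y] [x' y']; congr (_, _) => /=; first by rewrite rmulDr rmulZr.
rewrite !rmulDr !rmulZr.
rewrite (rmulCA k.+2 (l := k.+1)) // scalerDr addrACA.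
by rewrite (addrAC _ (rmul k.+2 (Rsh_of (D U a)) _)).
Qed.

Lemma jet_mulC U k m n (z : jet k U) :
  jet_mul m (jet_mul n z) = jet_mul n (jet_mul m z).
Proof.
case: z => x y; congr (_, _) => /=; first exact: rmulCA.
rewrite !rmulDr (rmulCA _ (l := k.+2) (Rsh_of m) (Rsh_of n)) // -!addrA; congr (_ + _).
rewrite (rmulCA _ (l := k.+1) (Rsh_of m)) // (rmulCA _ (l := k.+1) (Rsh_of n)) //.
by rewrite addrC.
Qed.

Definition geod_pre k U (p : Rpre F k U) : Rsh F k.+1 U :=
  (free_ext (Q := fun k => jet k U) (@jet_of U) (@jet_mul U) p).2.

Definition jet_res U V (VU : V `<=` U) k (z : jet k U) : jet k V :=
  (mres (Rsh F k) VU z.1, mres (Rsh F k.+1) VU z.2).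

Lemma geod_pre_res k U V (VU : V `<=` U) (p : Rpre F k U) :
  mres (Rsh F k.+1) VU (geod_pre p) = geod_pre (mres (Rpre F k) VU p).
Proof.

have psi0 m : jet_res VU (@jet_of U m) = jet_of (mres F VU m).
  exact: (congr2 pair (Rsh_of_res VU m) (gammaR_res VU m)).
have psiS l m z : jet_res VU (@jet_mul U l m z) = jet_mul (mres F VU m) (jet_res VU z).
  apply: (congr2 pair).
    by rewrite rmul_res Rsh_of_res.
  rewrite (semilinD (mres_lin (Rsh F _) VU)).
  by rewrite !rmul_res Rsh_of_res gammaR_res.
have psiL l : semilin (rres O VU) (@jet_res U V VU l).
  move=> a x y; apply: (congr2 pair (mres_lin (Rsh F l) VU a x.1 y.1)).
  rewrite !(semilinD (mres_lin (Rsh F _) VU)) (semilinZ (mres_lin (Rsh F _) VU)).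
  by rewrite rmul_res Rsh_of_res der_res.
exact: (congr1 snd (free_ext_map (mres_lin F VU) (@jet_of_lin U)
  (@jet_mul_linl U) (@jet_mul_linr U) (@jet_mulC U) (@jet_of_lin V)
  (@jet_mul_linl V) (@jet_mul_linr V) (@jet_mulC V) psiL psi0 psiS p)).
Qed.

Lemma free_ext_jet1 k U (p : Rpre F k U) :
  (free_ext (Q := fun k => jet k U) (@jet_of U) (@jet_mul U) p).1 = shunit p.
Proof.
have eL := free_ext_lin (@jet_of_lin U) (@jet_mul_linl U) (@jet_mul_linr U) (@jet_mulC U).
move: p; apply: (Rpow_eq (rho := idfun)) => [a p q|a p q|w wk].
- by rewrite eL.
- exact: (@shunit_lin _ _ (Rpre F k) U).
rewrite (free_ext_word (@jet_of_lin U) (@jet_mul_linl U) (@jet_mul_linr U) (@jet_mulC U)) //.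
elim: k w wk => [|k IHk] [//|m w] [wk]; first by case: w wk.
rewrite -[RHS]/(shword k.+1 ([:: m] ++ w)) -(rmul_word (a := 0) (b := k)) //.
exact: (congr1 (rmul k.+1 (Rsh_of m)) (IHk w wk)).
Qed.

Lemma geod_preD k U (p q : Rpre F k U) : geod_pre (p + q) = geod_pre p + geod_pre q.
Proof.
have eL := free_ext_lin (@jet_of_lin U) (@jet_mul_linl U) (@jet_mul_linr U) (@jet_mulC U).
by rewrite /geod_pre (semilinD (rho := idfun) (eL k)).
Qed.

Lemma geod_preZ k U a (p : Rpre F k U) :
  geod_pre (a *: p) = a *: geod_pre p + rmul k.+1 (Rsh_of (D U a)) (shunit p).
Proof.
have eL := free_ext_lin (@jet_of_lin U) (@jet_mul_linl U) (@jet_mul_linr U) (@jet_mulC U).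
by rewrite /geod_pre (semilinZ (rho := idfun) (eL k)) /= free_ext_jet1.
Qed.

(** The derivation of R(F) which is D on functions and gamma on F. On the symmetric
algebra it is the vector field of the geodesic flow of gamma on the total space of
the tangent bundle whose linear functions are the sections of F. *)
Definition geod k U : Rsh F k U -> Rsh F k.+1 U :=
  @shbind _ _ _ _ _ (@geod_pre_res k) U.

Lemma geod_unit k U (p : Rpre F k U) : geod (shunit p) = geod_pre p.
Proof. exact: shbind_unit. Qed.

Lemma geod_res k U V (VU : V `<=` U) (x : Rsh F k U) :
  mres (Rsh F k.+1) VU (geod x) = geod (mres (Rsh F k) VU x).
Proof. exact: shbind_res. Qed.

Lemma geodD k U (x y : Rsh F k U) : geod (x + y) = geod x + geod y.
Proof.
apply: Rsh_local => z Uz.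
have [V [VU [p [q [Vz xp yq]]]]] := Rsh_unit_ex2 x y Uz; exists V, VU; split=> //.
rewrite (semilinD (mres_lin (Rsh F _) VU)) !geod_res.
rewrite (semilinD (mres_lin (Rsh F _) VU)) xp yq.
by rewrite -(semilinD (rho := idfun) (@shunit_lin _ _ (Rpre F k) V)) !geod_unit geod_preD.
Qed.

Lemma geod0 k U : geod (0 : Rsh F k U) = 0.
Proof. by apply: (addrI (geod 0)); rewrite -geodD !addr0. Qed.

Lemma geodZ k U a (x : Rsh F k U) :
  geod (a *: x) = a *: geod x + rmul k.+1 (Rsh_of (D U a)) x.
Proof.
apply: Rsh_local => z Uz.
have [V [VU [p [Vz xp]]]] := sh_unit_ex x Uz; exists V, VU; split=> //.
rewrite (mres_lin (Rsh F _)) !geod_res (semilinZ (mres_lin (Rsh F _) VU)).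
rewrite rmul_res Rsh_of_res der_res xp.
by rewrite -(semilinZ (rho := idfun) (@shunit_lin _ _ (Rpre F k) V)) !geod_unit geod_preZ.
Qed.

Lemma geod_of U (m : F U) : geod (Rsh_of m) = gammaR m.
Proof.
rewrite geod_unit /geod_pre.
by rewrite (free_ext_of (@jet_of_lin U) (@jet_mul_linl U) (@jet_mul_linr U) (@jet_mulC U)).
Qed.

Lemma geod_of_mul k U (m : F U) (z : Rsh F k U) :
  geod (rmul k.+1 (Rsh_of m) z) =
  rmul k.+2 (geod (Rsh_of m)) z + rmul k.+2 (Rsh_of m) (geod z).
Proof.
apply: Rsh_local => x Ux.
have [V [VU [p [Vx zp]]]] := sh_unit_ex z Ux; exists V, VU; split=> //.
rewrite (semilinD (mres_lin (Rsh F _) VU)) !(geod_res, rmul_res) Rsh_of_res zp geod_of geod_unit.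
rewrite {1}/Rsh_of (rmulE (erefl : 0 + k.+1 = k.+1)%N) Rshcast_id Rshmul_unit geod_unit.
rewrite /geod_pre [in LHS](free_ext_mul (@jet_of_lin V) (@jet_mul_linl V) (@jet_mul_linr V) (@jet_mulC V)).
by rewrite /= free_ext_jet1 addrC.
Qed.

(** The first factor is general, whereas the construction only gives
the rule for a single letter; associativity does the induction. *)
Lemma geod_mul n U a b (x : Rsh F a U) (y : Rsh F b U) :
  geod (rmul n x y) = rmul n.+1 (geod x) y + rmul n.+1 x (geod y).
Proof.
have [en|ne] := eqVneq (a + b.+1)%N n; last first.
  by rewrite !rmul_neq ?geod0 ?addr0 //; lia.
move: a U x n b y en; apply: (Rsh_gen_ind (P := fun a U (x : Rsh F a U) =>
  forall n b (y : Rsh F b U), (a + b.+1 = n)%N ->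
  geod (rmul n x y) = rmul n.+1 (geod x) y + rmul n.+1 x (geod y))).
- move=> a U x h n b y en; apply: Rsh_local => u /h[V [VU [Vu hV]]].
  exists V, VU; split=> //; rewrite (semilinD (mres_lin (Rsh F _) VU)).
  by rewrite !(rmul_res, geod_res) hV.
- move=> a U; split=> [|r r' h h'] n b y en.
    by rewrite !(rmul0l, geod0) addr0.
  by rewrite !(rmulDl, geodD) h // h' // addrACA.
- by move=> U m n b y en; case: _ / en; rewrite geod_of_mul.
move=> a U m z IHz n b y en.
have {en}-> : n = (a + b.+1).+1 by rewrite -en.
rewrite [in RHS]geod_of_mul (rmulA _ (l := (a + b.+1)%N)) //.
rewrite geod_of_mul IHz // rmulDr rmulDl addrA; congr (_ + _ + _).
- by rewrite (rmulA _ (l := (a + b.+1)%N)).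
- by rewrite (rmulA _ (l := (a + b.+1).+1)).
- by rewrite (rmulA _ (l := (a + b.+1).+1)) ?addnS.
Qed.

End Operators.

(** * Horizontal differential and curvature *)

Lemma sub_cross (V : zmodType) (a b c d e f : V) :
  a + b + (c + d) - (a + e + (d + f)) = (c - e) + (b - f).
Proof.
rewrite !opprD addrACA [a + b + _]addrACA subrr add0r.
rewrite [c + d + _]addrA addrK addrACA [RHS]addrACA; congr (_ + _).
exact: addrC.
Qed.

Lemma sub_cross0 (V : zmodType) (p q r s t : V) :
  p + q + (r + s) - (t + r + (q + s)) = p - t.
Proof.
rewrite [t + r + _]addrACA opprD addrACA subrr addr0.
by rewrite opprD addrACA subrr addr0.
Qed.

Section Curvature.
Variables (X : topologicalType) (B : qalg_sheaf X) (O : alg_sheaf B).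
Variables (F : mod_sheaf O) (D : derivation F) (gamma : D_connection D).
Implicit Types (U V : opens X).

Local Notation geod := (@geod _ _ _ _ _ gamma _ _).

Lemma mresB k U V (VU : V `<=` U) (x y : Rsh F k U) :
  mres (Rsh F k) VU (x - y) = mres (Rsh F k) VU x - mres (Rsh F k) VU y.
Proof.
rewrite (semilinD (mres_lin (Rsh F k) VU)) -scaleN1r.
by rewrite (semilinZ (mres_lin (Rsh F k) VU)) rmorphN1 scaleN1r.
Qed.

(** Write the total differential of a polynomial function on the tangent bundle in
the splitting given by gamma. Its vertical part is sigma^*, and its horizontal part
is this operator: commuting with the flow forces the vertical part of
the Lie derivative of the differential to satisfy
sigma^* geod = geod sigma^* + hdiff. *)
Definition hdiff k U (x : Rsh F k U) : Rsh F k.+1 U :=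
  Rshsigma (geod x) - geod (Rshsigma x).

Lemma hdiff_res k U V (VU : V `<=` U) (x : Rsh F k U) :
  mres (Rsh F k.+1) VU (hdiff x) = hdiff (mres (Rsh F k) VU x).
Proof. by rewrite mresB Rshsigma_res !geod_res Rshsigma_res. Qed.

Lemma hdiffD k U (x y : Rsh F k U) : hdiff (x + y) = hdiff x + hdiff y.
Proof. by rewrite /hdiff geodD !RshsigmaD geodD opprD addrACA. Qed.

(** The terms D(a) sigma^*(x) cancel; what survives is the term in
which the letter D(a) is moved last. *)
Lemma hdiffZ k U a (x : Rsh F k U) :
  hdiff (a *: x) = a *: hdiff x + rmul k.+1 x (Rsh_of (D U a)).
Proof.
rewrite /hdiff geodZ RshsigmaD !RshsigmaZ geodZ Rshsigma_mul // Rshsigma_of.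
rewrite scalerBr opprD addrACA [RHS]addrC addrC; congr (_ + _).
by rewrite addrAC subrr add0r.
Qed.

Lemma hdiff_mul n U a b (x : Rsh F a U) (y : Rsh F b U) : (a + b.+1 = n)%N ->
  hdiff (rmul n x y) = rmul n.+1 x (hdiff y) + rmul n.+1 y (hdiff x).
Proof.
move=> en; rewrite /hdiff geod_mul RshsigmaD !Rshsigma_mul; try lia.
rewrite geodD !geod_mul !rmulBr.
exact: sub_cross.
Qed.

Definition curv k U (x : Rsh F k U) : Rsh F k.+2 U := hdiff (geod x) - geod (hdiff x).

Lemma curv_res k U V (VU : V `<=` U) (x : Rsh F k U) :
  mres (Rsh F k.+2) VU (curv x) = curv (mres (Rsh F k) VU x).
Proof. by rewrite mresB hdiff_res !geod_res hdiff_res. Qed.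

Lemma curvD k U (x y : Rsh F k U) : curv (x + y) = curv x + curv y.
Proof. by rewrite /curv geodD !hdiffD geodD opprD addrACA. Qed.

Lemma curv_mul n U a b (x : Rsh F a U) (y : Rsh F b U) : (a + b.+1 = n)%N ->
  curv (rmul n x y) = rmul n.+2 x (curv y) + rmul n.+2 y (curv x).
Proof.
move=> en; rewrite /curv geod_mul hdiffD !hdiff_mul; try lia.
rewrite geodD !geod_mul !rmulBr.
exact: sub_cross.
Qed.

Hypothesis flat : D_flat gamma.

(** This is where flatness enters. On F the operator hdiff is gamma
followed by the exchange of the two tensor factors, and gamma(D(a)) is
symmetric: sigma^*(t) = t + switch t is invariant under the exchange because the
latter is an involution in degree two. *)
Lemma hdiff_der U (a : O U) : hdiff (Rsh_of (D U a)) = geod (Rsh_of (D U a)).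
Proof.
rewrite /hdiff Rshsigma_of RshsigmaE addrC addKr geod_of.
apply: Rsh_local => x /(@flat U a x)[V [VU [Vx [t gt]]]]; exists V, VU; split=> //.
(* Now sigma^* g - g = switch g for g = gamma(D(a)), and locally g = sigma^* t. *)
rewrite Rshswitch_res -[gammaR _ _]/(T2sh_Rsh _) {}gt RshsigmaE.
by rewrite (semilinD (@Rshswitch_lin _ _ F 1 V)) Rshswitch_invol addrC.
Qed.

(** All terms with the letter D(a) cancel in pairs, except for
x hdiff(D(a)) - x geod(D(a)), which vanishes by flatness. *)
Lemma curvZ k U a (x : Rsh F k U) : curv (a *: x) = a *: curv x.
Proof.
rewrite /curv geodZ hdiffZ hdiffD !hdiffZ hdiff_mul // hdiff_der.
rewrite geodD geodZ geod_mul scalerBr.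
exact: sub_cross0.
Qed.

Lemma curv_of_lin U : semilin idfun (fun m : F U => curv (Rsh_of m)).
Proof. by move=> a m n; rewrite Rsh_ofD Rsh_ofZ curvD curvZ. Qed.

Definition letter_mul k U (m : F U) (z : Rsh F k.+2 U) : Rsh F k.+3 U :=
  rmul k.+3 (Rsh_of m) z.

Lemma letter_mul_linl U k z : semilin idfun (fun m => @letter_mul k U m z).
Proof. by move=> a m n; rewrite /letter_mul Rsh_ofD Rsh_ofZ rmulDl rmulZl. Qed.

Lemma letter_mul_linr U k m : semilin idfun (@letter_mul k U m).
Proof. by move=> a z z'; rewrite /letter_mul rmulDr rmulZr. Qed.

Lemma letter_mulC U k m n (z : Rsh F k.+2 U) :
  letter_mul (k := k.+1) m (letter_mul n z) = letter_mul (k := k.+1) n (letter_mul m z).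
Proof. exact: rmulCA. Qed.

Definition jacobi_pre k U (p : Rpre F k U) : Rsh F k.+2 U :=
  free_ext (Q := fun k => Rsh F k.+2 U) (fun m : F U => curv (Rsh_of m))
    (fun k => @letter_mul k U) p.

Let jacobi_preL U := free_ext_lin (@curv_of_lin U) (fun k => @letter_mul_linl U k)
  (@letter_mul_linr U) (@letter_mulC U).

Lemma jacobi_pre_res k U V (VU : V `<=` U) (p : Rpre F k U) :
  mres (Rsh F k.+2) VU (jacobi_pre p) = jacobi_pre (mres (Rpre F k) VU p).
Proof.
have psi0 m : mres (Rsh F 2) VU (curv (Rsh_of m)) = curv (Rsh_of (mres F VU m)).
  by rewrite curv_res Rsh_of_res.
have psiS l m z : mres (Rsh F l.+3) VU (@letter_mul l U m z) =
    letter_mul (mres F VU m) (mres (Rsh F l.+2) VU z).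
  by rewrite rmul_res Rsh_of_res.
exact: (free_ext_map (psi := fun k => @mres X O (Rsh F k.+2) U V VU)
  (mres_lin F VU) (@curv_of_lin U)
  (fun k => @letter_mul_linl U k) (@letter_mul_linr U) (@letter_mulC U)
  (@curv_of_lin V) (fun k => @letter_mul_linl V k) (@letter_mul_linr V)
  (@letter_mulC V) (fun k => mres_lin (Rsh F k.+2) VU) psi0 psiS).
Qed.

(** The S(F)-linear map S(F) (x) F -> S(F) (x) F which is curv on F, that is the
curvature term in the equation of Jacobi fields. *)
Definition jacobi k U : Rsh F k U -> Rsh F k.+2 U :=
  @shbind _ _ _ _ _ (@jacobi_pre_res k) U.

Lemma jacobi_unit k U (p : Rpre F k U) : jacobi (shunit p) = jacobi_pre p.
Proof. exact: shbind_unit. Qed.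

Lemma jacobi_res k U V (VU : V `<=` U) (x : Rsh F k U) :
  mres (Rsh F k.+2) VU (jacobi x) = jacobi (mres (Rsh F k) VU x).
Proof. exact: shbind_res. Qed.

Lemma jacobi_lin k U : semilin idfun (@jacobi k U).
Proof.
move=> a x y; apply: Rsh_local => z Uz.
have [V [VU [p [q [Vz xp yq]]]]] := Rsh_unit_ex2 x y Uz; exists V, VU; split=> //.
rewrite !(jacobi_res, mres_lin (Rsh F _)) xp yq.
by rewrite -shunit_lin !jacobi_unit; apply: jacobi_preL.
Qed.

Lemma jacobiD k U (x y : Rsh F k U) : jacobi (x + y) = jacobi x + jacobi y.
Proof. exact: (semilinD (rho := idfun) (@jacobi_lin k U)). Qed.

Lemma jacobiZ k U a (x : Rsh F k U) : jacobi (a *: x) = a *: jacobi x.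
Proof. exact: (semilinZ (rho := idfun) (@jacobi_lin k U)). Qed.

Lemma jacobi0 k U : jacobi (0 : Rsh F k U) = 0.
Proof. exact: (semilin0 (rho := idfun) (@jacobi_lin k U)). Qed.

Lemma jacobi_of U (m : F U) : jacobi (Rsh_of m) = curv (Rsh_of m).
Proof.
rewrite jacobi_unit.
exact: (free_ext_of (@curv_of_lin U) (fun k => @letter_mul_linl U k)
  (@letter_mul_linr U) (@letter_mulC U)).
Qed.

Lemma jacobi_of_mul k U (m : F U) (z : Rsh F k U) :
  jacobi (rmul k.+1 (Rsh_of m) z) = rmul k.+3 (Rsh_of m) (jacobi z).
Proof.
apply: Rsh_local => x Ux.
have [V [VU [p [Vx zp]]]] := sh_unit_ex z Ux; exists V, VU; split=> //.
rewrite !(jacobi_res, rmul_res) Rsh_of_res zp jacobi_unit.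
rewrite {1}/Rsh_of (rmulE (erefl : 0 + k.+1 = k.+1)%N) Rshcast_id Rshmul_unit jacobi_unit.
exact: (free_ext_mul (@curv_of_lin V) (fun k => @letter_mul_linl V k)
  (@letter_mul_linr V) (@letter_mulC V)).
Qed.

Lemma jacobi_mul n U a b (x : Rsh F a U) (y : Rsh F b U) :
  jacobi (rmul n x y) = rmul n.+2 x (jacobi y).
Proof.
have [en|ne] := eqVneq (a + b.+1)%N n; last first.
  by rewrite !rmul_neq ?jacobi0 //; lia.
move: a U x n b y en; apply: (Rsh_gen_ind (P := fun a U (x : Rsh F a U) =>
  forall n b (y : Rsh F b U), (a + b.+1 = n)%N ->
  jacobi (rmul n x y) = rmul n.+2 x (jacobi y))).
- move=> a U x h n b y en; apply: Rsh_local => u /h[V [VU [Vu hV]]].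
  by exists V, VU; rewrite !(rmul_res, jacobi_res) hV.
- move=> a U; split=> [|r r' h h'] n b y en.
    by rewrite !(rmul0l, jacobi0).
  by rewrite !(rmulDl, jacobiD) h // h'.
- by move=> U m n b y en; case: _ / en; rewrite jacobi_of_mul.
move=> a U m z IHz n b y en.
have {en}-> : n = (a + b.+1).+1 by rewrite -en.
rewrite (rmulA _ (l := (a + b.+1)%N)) // jacobi_of_mul IHz //.
by rewrite (rmulA _ (l := (a + b.+1).+2)) ?addnS.
Qed.

(** Both sides are derivations in the sense of [Rshsigma_mul] and they
agree on F, where sigma^* is the identity. *)
Lemma curvE k U (x : Rsh F k U) : curv x = jacobi (Rshsigma x).
Proof.
move: k U x; apply: Rsh_gen_ind.
- move=> k U x h; apply: Rsh_local => u /h[V [VU [Vu hV]]].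
  by exists V, VU; rewrite curv_res jacobi_res Rshsigma_res.
- move=> k U; split=> [|x y hx hy]; last by rewrite curvD RshsigmaD jacobiD hx hy.
  rewrite Rshsigma0 jacobi0; apply: (addrI (curv 0)).
  by rewrite -curvD !addr0.
- by move=> U m; rewrite Rshsigma_of jacobi_of.
move=> k U m z IHz.
rewrite curv_mul // IHz Rshsigma_mul // jacobiD !jacobi_mul.
by rewrite Rshsigma_of jacobi_of.
Qed.

End Curvature.

(** * Exponential of the geodesic derivation *)

Lemma addr6_shuffle (V : zmodType) (p q s t r u : V) :
  p + q + (s + t) + (r + u) = p + r + (q + s + (t + u)).
Proof. by rewrite (AC ((2*2)*2) ((1*5)*((2*3)*(4*6)))). Qed.

Lemma addr6_shuffle_mid (V : zmodType) (p h r q s t : V) :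
  p + h + (r + q + (s + t)) = p + r + (q + s + (h + t)).
Proof. by rewrite (AC (2*(2*2)) ((1*3)*((4*5)*(2*6)))). Qed.

Section Exponential.

Variables (X : topologicalType) (B : qalg_sheaf X) (O : alg_sheaf B).
Variables (F : mod_sheaf O) (D : derivation F) (gamma : D_connection D).
Hypothesis flat : D_flat gamma.
Implicit Types (U V : opens X).

Local Notation geod := (@geod _ _ _ _ _ gamma _ _).
Local Notation hdiff := (@hdiff _ _ _ _ _ gamma _ _).
Local Notation jacobi := (@jacobi _ _ _ _ _ _ flat _ _).

(** The n-th Lie derivative, along the geodesic flow, of a one-form m pulled
back from the base has a horizontal part in R^(n+1)(F) and a vertical part in R^n(F).
A state holds the horizontal parts of orders n and n + 1 and the vertical part of
order n + 1: thus all degrees are positive, and the step is defined without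
subtraction of indices. *)
Record flow_state U n := FlowState {
  hor : Rsh F n U;
  hor_next : Rsh F n.+1 U;
  ver : Rsh F n U
}.

(** The Lie derivative sends the horizontal form x to the horizontal form geod x
plus the vertical form x, and the vertical form y to the vertical form geod y plus
the horizontal form jacobi y. *)
Definition flow_step U n (z : flow_state U n) : flow_state U n.+1 :=
  FlowState (hor_next z) (geod (hor_next z) + jacobi (ver z))
    (hor_next z + geod (ver z)).

Fixpoint flow U n (m : F U) : flow_state U n :=
  if n is n'.+1 then flow_step (flow n' m)
  else FlowState (Rsh_of m) (geod (Rsh_of m)) (Rsh_of m).

Definition hflow U n (m : F U) : Rsh F n U := hor (flow n m).
Definition vflow U n (m : F U) : Rsh F n U := ver (flow n m).

Lemma hflowSS U n (m : F U) :
  hflow n.+2 m = geod (hflow n.+1 m) + jacobi (vflow n m).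
Proof. by []. Qed.

Lemma vflowS U n (m : F U) : vflow n.+1 m = hflow n.+1 m + geod (vflow n m).
Proof. by case: n. Qed.

Lemma hflow1 U (m : F U) : hflow 1 m = geod (Rsh_of m).
Proof. by []. Qed.

Lemma flow_res U V (VU : V `<=` U) n (m : F U) :
  mres (Rsh F n.+1) VU (hflow n.+1 m) = hflow n.+1 (mres F VU m) /\
  mres (Rsh F n) VU (vflow n m) = vflow n (mres F VU m).
Proof.
elim: n => [|n [hh hv]]; first by rewrite !hflow1 geod_res Rsh_of_res.
have hh2 : mres (Rsh F n.+2) VU (hflow n.+2 m) = hflow n.+2 (mres F VU m).
  rewrite !hflowSS (semilinD (mres_lin (Rsh F _) VU)).
  by rewrite geod_res jacobi_res hh hv.
split=> //; rewrite !vflowS (semilinD (mres_lin (Rsh F _) VU)).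
by rewrite geod_res hh hv.
Qed.

Lemma flowD U n (m m' : F U) :
  hflow n.+1 (m + m') = hflow n.+1 m + hflow n.+1 m' /\
  vflow n (m + m') = vflow n m + vflow n m'.
Proof.
elim: n => [|n [hh hv]]; first by rewrite !hflow1 -geodD -!Rsh_ofD.
have hh2 : hflow n.+2 (m + m') = hflow n.+2 m + hflow n.+2 m'.
  by rewrite !hflowSS hh hv geodD jacobiD addrACA.
by split=> //; rewrite !vflowS hh hv geodD addrACA.
Qed.

Fixpoint geod_iter U n (a : O U) : Rsh F n U :=
  if n is n'.+1 then geod (geod_iter n' a) else Rsh_of (D U a).

(** For m = D(a) the iterated Lie derivatives are the differentials of
the iterated derivatives of the function a, whose vertical part is sigma^* and whose
horizontal part is hdiff. This gives the flatness of the exponential. *)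
Lemma flow_der U n (a : O U) :
  hflow n.+1 (D U a) = hdiff (geod_iter n a) /\ vflow n (D U a) = Rshsigma (geod_iter n a).
Proof.
elim: n => [|n [hh hv]]; first by rewrite hflow1 hdiff_der // Rshsigma_of.
split.
  rewrite hflowSS hh hv -curvE; first by rewrite addrC subrK.
by rewrite vflowS hh hv subrK.
Qed.

(** The terms of positive order in a of the i-th derivative of a product a f. *)
Definition leibniz_sum U n i (f : forall k, Rsh F k U) (a : O U) : Rsh F n U :=
  \sum_(j < n) rmul n (geod_iter j a) (f (n - j.+1)%N) *+ 'C(i, j.+1).

Lemma leibniz_sum_pascal U n i (f : forall k, Rsh F k U) (a : O U) :
  rmul n.+1 (Rsh_of (D U a)) (f n) +
    \sum_(j < n) rmul n.+1 (geod_iter j.+1 a) (f (n - j.+1)%N) *+ 'C(i, j.+1) +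
    leibniz_sum n.+1 i f a = leibniz_sum n.+1 i.+1 f a.
Proof.
(* The first two summands together are the sum of the G j with coefficients
   C(i, j), the first one being the term j = 0; Pascal's rule then applies termwise. *)
pose G j := rmul n.+1 (geod_iter j a) (f (n - j)%N).
have -> : rmul n.+1 (Rsh_of (D U a)) (f n) +
    \sum_(j < n) rmul n.+1 (geod_iter j.+1 a) (f (n - j.+1)%N) *+ 'C(i, j.+1) =
    \sum_(j < n.+1) G j *+ 'C(i, j).
  by rewrite big_ord_recl bin0 mulr1n /G subn0.
rewrite -big_split; apply: eq_bigr => j _.
by rewrite /= subSS -/(G j) binS mulrnDr addrC.
Qed.

Lemma geod_leibniz_sum U n i (f : forall k, Rsh F k U) (a : O U) :
  geod (leibniz_sum n i f a) =
  \sum_(j < n) rmul n.+1 (geod_iter j.+1 a) (f (n - j.+1)%N) *+ 'C(i, j.+1) +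
  \sum_(j < n) rmul n.+1 (geod_iter j a) (geod (f (n - j.+1)%N)) *+ 'C(i, j.+1).
Proof.
rewrite -big_split (big_morph _ (@geodD _ _ _ _ _ gamma n U) (geod0 gamma n U)).
apply: eq_bigr => j _ /=; rewrite -mulrnDl -geod_mul.
by elim: 'C(i, _) => [|c IHc]; rewrite ?mulr0n ?geod0 // !mulrS geodD IHc.
Qed.

Lemma jacobi_leibniz_sum U n i (f : forall k, Rsh F k U) (a : O U) :
  jacobi (leibniz_sum n i f a) =
  \sum_(j < n) rmul n.+2 (geod_iter j a) (jacobi (f (n - j.+1)%N)) *+ 'C(i, j.+1).
Proof.
rewrite (semilin_sum _ _ _ (@jacobi_lin _ _ _ _ _ _ flat n U)).
apply: eq_bigr => j _; rewrite (semilinMn _ _ (@jacobi_lin _ _ _ _ _ _ flat n U)).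
by rewrite jacobi_mul.
Qed.

(** The Leibniz formula for iterated Lie derivatives. The vertical part is one
step ahead of its index, whence the binomial coefficients of n + 1 for it. *)
Lemma flowZ U n a (m : F U) :
  hflow n.+1 (a *: m) = a *: hflow n.+1 m + leibniz_sum n.+1 n.+1 (fun k => hflow k m) a /\
  vflow n (a *: m) = a *: vflow n m + leibniz_sum n n.+1 (fun k => vflow k m) a.
Proof.
elim: n => [|n [hh hv]].
  split; last by rewrite /leibniz_sum big_ord0 addr0 /vflow /= Rsh_ofZ.
  by rewrite !hflow1 Rsh_ofZ geodZ /leibniz_sum big_ord1.
split.
  rewrite hflowSS hh hv geodD geodZ geod_leibniz_sum jacobiD jacobiZ jacobi_leibniz_sum.
  rewrite hflowSS scalerDr -leibniz_sum_pascal.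
  (* The term j = n + 1 has coefficient zero; in the others the horizontal
     recursion is applied, except for j = n, where there is no vertical part. *)
  have -> : leibniz_sum n.+2 n.+1 (fun k => hflow k m) a =
      \sum_(j < n.+1) rmul n.+2 (geod_iter j a) (geod (hflow (n - j) m)) *+ 'C(n.+1, j.+1) +
      \sum_(j < n) rmul n.+2 (geod_iter j a) (jacobi (vflow (n - j.+1) m)) *+ 'C(n.+1, j.+1).
    rewrite /leibniz_sum big_ord_recr bin_small //= mulr0n addr0.
    rewrite big_ord_recr [in RHS]big_ord_recr /= -addrA [X in _ = _ + X]addrC addrA.
    rewrite -big_split; congr (_ + _); last by rewrite !subSS subSnn subnn.
    apply: eq_bigr => j _ /=; rewrite -mulrnDl subSS (subSn (ltnW (ltn_ord j))).
    by rewrite -(subnSK (ltn_ord j)) hflowSS rmulDr.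
  exact: addr6_shuffle.
rewrite vflowS hh hv geodD geodZ geod_leibniz_sum vflowS scalerDr.
rewrite -(leibniz_sum_pascal _ _ (fun k => vflow k m)).
(* Vertical recursion in all terms but j = n, where both flows are m. *)
have -> : leibniz_sum n.+1 n.+1 (fun k => vflow k m) a =
    leibniz_sum n.+1 n.+1 (fun k => hflow k m) a +
    \sum_(j < n) rmul n.+1 (geod_iter j a) (geod (vflow (n - j.+1) m)) *+ 'C(n.+1, j.+1).
  rewrite /leibniz_sum big_ord_recr [in RHS]big_ord_recr /= addrAC -big_split.
  congr (_ + _); last by rewrite !subnn.
  apply: eq_bigr => j _ /=; rewrite -mulrnDl subSS.
  by rewrite -(subnSK (ltn_ord j)) vflowS rmulDr.
exact: addr6_shuffle_mid.
Qed.

Definition ratO U : {rmorphism rat -> O U} := alg O \o qalg B.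

Lemma ratO_res U V (VU : V `<=` U) r : rres O VU (ratO U r) = ratO V r.
Proof. by rewrite /= alg_res qalg_res. Qed.

(** The vertical part of exp(L)(m) in degree i + 1, for the Lie derivative L: the
vertical part of order i + 1 is indexed by i. *)
Definition expT i U (m : F U) : Rsh F i U := ratO U (i.+1)`!%:R^-1 *: vflow i m.

Lemma expT_res i U V (VU : V `<=` U) (m : F U) :
  mres (Rsh F i) VU (expT i m) = expT i (mres F VU m).
Proof.
rewrite (semilinZ (mres_lin (Rsh F i) VU)) ratO_res.
by case: (flow_res VU i m) => _ ->.
Qed.

Lemma geod_iter_alg n U (b : B U) : geod_iter n (alg O b) = 0.
Proof. by elim: n => [|n IHn] /=; rewrite ?der_alg ?Rsh_of0 // IHn geod0. Qed.

(** Scalars from the base are killed by D, hence [flowZ] reduces to linearity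
for them. *)
Lemma expT_lin i U (b : B U) (m m' : F U) :
  expT i (alg O b *: m + m') = alg O b *: expT i m + expT i m'.
Proof.
rewrite /expT; case: (flowD i (alg O b *: m) m') => _ ->.
case: (flowZ i (alg O b) m) => _ ->.
rewrite /leibniz_sum big1 ?addr0 => [|j _]; last by rewrite geod_iter_alg rmul0l mul0rn.
by rewrite scalerDr !scalerA mulrC.
Qed.

Definition expT_hom i : B_hom F (Rsh F i) := BHom (@expT_res i) (@expT_lin i).

Lemma expT0 U (m : F U) : expT 0 m = Rsh_of m.
Proof. by rewrite /expT invr1 rmorph1 scale1r. Qed.

Lemma expT_der i U (a : O U) :
  expT i (D U a) = Rshsigma (ratO U (i.+1)`!%:R^-1 *: geod_iter i a).
Proof. by rewrite /expT RshsigmaZ; case: (flow_der i a) => _ ->. Qed.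

(** The factor j + 1 comes from [rmul_sigmal], and its inverse is the
coefficient in the definition of extended connections. *)
Lemma binomial_split i j : (j <= i)%N ->
  ((i.+2)`!%:R^-1 * 'C(i.+2, j.+1)%:R =
   (j.+1)%:R^-1 * (j.+1)%:R * ((j.+1)`!%:R^-1 * ((i - j).+1)`!%:R^-1) :> rat)%R.
Proof.
move=> ji; have ne0 k : (k`!)%:R != 0 :> rat by rewrite Num.Theory.pnatr_eq0 -lt0n fact_gt0.
have jne0 : (j.+1)%:R != 0 :> rat by rewrite Num.Theory.pnatr_eq0.
have Cne0 : 'C(i.+2, j.+1)%:R != 0 :> rat by rewrite Num.Theory.pnatr_eq0 -lt0n bin_gt0; lia.
have <- : ('C(i.+2, j.+1) * ((j.+1)`! * (i - j).+1`!) = (i.+2)`!)%N.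
  by rewrite -(@bin_fact i.+2 j.+1) ?subSS ?subSn //; lia.
rewrite natrM (natrM _ _ (i - j).+1`!); move: (ne0 (i - j).+1) (ne0 j.+1) jne0 Cne0.
move: ((i - j).+1`!%:R) ((j.+1)`!%:R) (j.+1)%:R 'C(_, _)%:R => p q r c p0 q0 r0 c0.
by field; rewrite p0 q0 r0 c0.
Qed.

Lemma Rsh_mulrn n U (x : Rsh F n U) k : x *+ k = ratO U k%:R *: x.
Proof. by rewrite rmorph_nat scaler_nat. Qed.

Lemma expTM i U (a : O U) (m : F U) :
  expT i.+1 (a *: m) = a *: expT i.+1 m +
    \sum_(j < i.+1) inv_succ O U j *:
      Rshcast (ext_index j) (Rshmul (expT j (D U a)) (expT (i - j)%N m)).
Proof.
rewrite {1}/expT; case: (flowZ i.+1 a m) => _ ->.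
rewrite scalerDr scalerA mulrC -scalerA; congr (_ + _).
rewrite scaler_sumr; apply: eq_bigr => j _.
rewrite -rmulE expT_der rmul_sigmal rmulZl rmulZr subSS.
rewrite -[inv_succ _ _ _]/(ratO U _).
rewrite !Rsh_mulrn !scalerA -!rmorphM binomial_split; last by rewrite -ltnS.
by [].

Qed.

End Exponential.

Theorem theorem4p1 (X : topologicalType) (OB : qalg_sheaf X) (OX : alg_sheaf OB)
    (F : mod_sheaf OX) (D : derivation F) :
  D_integrable D -> exists T : ext_connection D, ext_flat T.
Proof.
move=> [gamma flat].
exists (ExtConnection (econn := expT_hom flat) (expT0 flat) (expTM flat)).
(* The section T_i(D(a)) is globally in the image of sigma^*. *)
move=> i U a x Ux; exists U, (@subset_refl _ U); split=> //.
exists (ratO OX U (i.+1)`!%:R^-1 *: geod_iter gamma i a).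
by rewrite mres_id; apply: expT_der.
Qed.
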